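(* Let $K$ be a field, $f:\mathbb Z_{\ge0}\to\mathbb R_{\ge0}$ an increasing function with $\sum_{\alpha\ge0}f(2^\alpha)/2^\alpha<+\infty$, and $B=\bigoplus_{n\ge0}B_n$ an integral graded $K$-algebra of finite type, generated by $B_1$. Suppose (i) the Krull dimension of $B$ is $>0$; (ii) each $B_n$ ($n\ge1$) carries a separated, exhaustive, left continuous $\mathbb R$-filtration making $B$ an $f$-pseudo-filtered graded $K$-algebra; (iii) $\limsup_{n\to\infty}\sup_{0\ne a\in B_n}\lambda(a)/n<+\infty$. Let $\nu_n=T_{1/n}\nu_{B_n}$. Then the supports of the $\nu_n$ ($n\ge1$) lie in a common bounded interval and $(\nu_n)_{n\ge1}$ converges vaguely to a Borel probability measure on $\mathbb R$.
   Context: Filtrations: decreasing families $(B_{n,s})_{s\in\mathbb R}$ of subspaces; separated: $\bigcap_sB_{n,s}=0$; exhaustive: $\bigcup_sB_{n,s}=B_n$; left continuous: $B_{n,s}=\bigcap_{t<s}B_{n,t}$; index $\lambda(a)=\sup\{s:a\in B_{n,s}\}$. $B$ is $f$-pseudo-filtered if $B_{n,s}B_{m,t}\subseteq B_{n+m,\,s+t-f(n)-f(m)}$ for all sufficiently large integers $n,m$ and all $s,t\in\mathbb R$. For nonzero finite-dimensional $W$, $\nu_W$ is the Borel probability measure with $\nu_W([r,+\infty[)=\dim\mathcal F_rW/\dim W$. $T_\varepsilon\nu$: image of $\nu$ under $x\mapsto\varepsilon x$. Vague convergence: convergence of integrals of continuous compactly supported functions. *)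

(* Defs.v *)
From HB Require Import structures.
From mathcomp Require Import all_boot all_order all_algebra.
From mathcomp Require Import all_classical all_reals all_analysis.
From mathcomp Require Import measurable_realfun.
Set Implicit Arguments. Unset Strict Implicit. Unset Printing Implicit Defensive.
Import Order.TTheory GRing.Theory Num.Theory.
Import numFieldNormedType.Exports.
Local Open Scope ring_scope.
Local Open Scope classical_set_scope.

Section LinAlg.
Context (K : fieldType) (A : lmodType K).

Definition is_subspace (W : A -> Prop) : Prop :=
  W 0 /\ forall (c : K) (u v : A), W u -> W v -> W (c *: u + v).

Definition lin_free (s : seq A) : Prop :=
  forall c : 'I_(size s) -> K,
    \sum_(i < size s) c i *: s`_i = 0 -> forall i, c i = 0.

Definition has_dim (W : A -> Prop) (d : nat) : Prop :=
  (exists s : seq A, size s = d /\ (forall x, x \in s -> W x) /\ lin_free s) /\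
  (forall s : seq A, (forall x, x \in s -> W x) -> lin_free s -> (size s <= d)%N).

End LinAlg.

Section Alg.
Context (K : fieldType) (A : comAlgType K).

Definition in_alg_gen (P : A -> Prop) (a : A) : Prop :=
  exists (k : nat) (c : 'I_k -> K) (t : 'I_k -> seq A),
    (forall i x, x \in t i -> P x) /\
    a = \sum_(i < k) c i *: \prod_(x <- t i) x.

Definition finite_type_alg : Prop :=
  exists s : seq A, forall a : A, in_alg_gen (fun x => x \in s) a.

Definition integral_alg : Prop :=
  (1 : A) != 0 /\ forall a b : A, a * b = 0 -> a = 0 \/ b = 0.

Definition prime_ideal (P : A -> Prop) : Prop :=
  [/\ P 0, (forall a b, P a -> P b -> P (a - b)),
      (forall r a, P a -> P (r * a)), ~ P 1 &
      (forall a b, P (a * b) -> P a \/ P b)].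

Definition krull_dim_pos : Prop :=
  exists P Q : A -> Prop, prime_ideal P /\ prime_ideal Q /\
    (forall x, P x -> Q x) /\ (exists x, Q x /\ ~ P x).

Definition graded_alg (B : nat -> A -> Prop) : Prop :=
  [/\ (forall n, is_subspace (B n)),
      B 0 1,
      (forall n m a b, B n a -> B m b -> B (n + m)%N (a * b)),
      (forall a : A, exists (N : nat) (c : 'I_N -> A),
          (forall i : 'I_N, B i (c i)) /\ a = \sum_(i < N) c i) &
      (forall (N : nat) (c : 'I_N -> A),
          (forall i : 'I_N, B i (c i)) -> \sum_(i < N) c i = 0 ->
          forall i, c i = 0)].

Definition generated_by (P : A -> Prop) : Prop :=
  forall a : A, in_alg_gen P a.

End Alg.

Section Filt.
Context (R : realType) (K : fieldType) (A : lmodType K).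

Definition good_filtration (W : A -> Prop) (F : R -> A -> Prop) : Prop :=
  [/\ (forall s, is_subspace (F s) /\ forall a, F s a -> W a),
      (forall s t a, s <= t -> F t a -> F s a),
      (forall a, (forall s, F s a) -> a = 0),
      (forall a, W a -> exists s, F s a) &
      (forall s a, (forall t, t < s -> F t a) -> F s a)].

Definition flambda (F : R -> A -> Prop) (a : A) : \bar R :=
  ereal_sup [set s%:E | s in [set s | F s a]].

End Filt.

Section Meas.
Context (R : realType).
Local Open Scope ereal_scope.

Definition is_filtration_measure (K : fieldType) (A : lmodType K)
  (W : A -> Prop) (F : R -> A -> Prop) (nu : {measure set R -> \bar R}) : Prop :=
  forall (r : R) (d dr : nat), has_dim W d -> has_dim (F r) dr ->
    nu `[r, +oo[ = (dr%:R / d%:R)%:E.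

Section Tscale.
Context (eps : R) (nu : {measure set R -> \bar R}).
Definition Tscale := pushforward nu (fun x : R => (x * eps)%R).

Let mf : measurable_fun [set: R] (fun x : R => (x * eps)%R).
Proof. exact: mulrr_measurable. Qed.

Let Tscale0 : Tscale set0 = 0.
Proof. by rewrite /Tscale /pushforward preimage_set0 measure0. Qed.

Let Tscale_ge0 B : 0 <= Tscale B.
Proof. exact: measure_ge0. Qed.

Let Tscale_sigma_additive : semi_sigma_additive Tscale.
Proof.
move=> F mF tF mUF; rewrite /Tscale /pushforward preimage_bigcup.
apply: measure_semi_sigma_additive.
- by move=> n; rewrite -[X in measurable X]setTI; exact: mf.
- apply/trivIsetP => /= i j _ _ ij; rewrite -preimage_setI.
  by move/trivIsetP : tF => /(_ _ _ _ _ ij) ->//; rewrite preimage_set0.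
- by rewrite -preimage_bigcup -[X in measurable X]setTI; exact: mf.
Qed.

HB.instance Definition _ := isMeasure.Build _ _ _
  Tscale Tscale0 Tscale_ge0 Tscale_sigma_additive.
End Tscale.

Definition msupport (nu : {measure set R -> \bar R}) : set R :=
  [set x : R | forall U : set R, open U -> U x -> 0 < nu U].

Definition vague_cvg (nus : nat -> {measure set R -> \bar R})
    (nu : {measure set R -> \bar R}) : Prop :=
  forall phi : R -> R, continuous phi ->
    compact (closure [set x | phi x != 0%R]) ->
    (fun n => \int[nus n]_x (phi x)%:E) @ \oo --> \int[nu]_x (phi x)%:E.

End Meas.

(* Main.v *)
Require Import Defs.
From HB Require Import structures.
From mathcomp Require Import all_boot all_order all_algebra.
From mathcomp Require Import all_classical all_reals all_analysis.
From mathcomp Require Import measurable_realfun zify ring lra.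
Set Implicit Arguments. Unset Strict Implicit. Unset Printing Implicit Defensive.
Import Order.TTheory GRing.Theory Num.Theory.
Import numFieldNormedType.Exports.
Local Open Scope ring_scope.
Local Open Scope classical_set_scope.

(** Instead of Okounkov bodies, the proof compares dimensions in two degrees directly.  Let x0 be a
nonzero element of B_1, and y a transcendence basis, with d elements, of the degree-0 fractions,
taken among the x / x0 with x in B_1.  Chevalley's extension theorem gives a valuation of Frac B
which is injective on the monomials in y.  Since dim B_n = O(n^d), its leaves have bounded dimension
(let c_1, .., c_kappa span a leaf of maximal dimension), and every value has a multiple of bounded
order that is the value of a quotient of monomials.  A subspace W of B_p of dimension h contains at
least h / kappa elements w_i with distinct values.  If k is 1 modulo all those orders, the products
w_i^k y^b c_j with 0 <= b < k are linearly independent: the k-th powers of elements of W, times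
elements of degree about k d, span at least k^d h dimensions.

For W = F_(pt) B_p, a k-th power bracketed by halving loses at most about k sum_i f(2^i p) / 2^i,
which is o(kp).  Hence dim F_(n(t-e)) B_n >= ((1-e) n / p)^d dim F_(pt) B_p for n >> p >> 0, so the
lower limit of the tails nu_n [t-e, +oo[ is at least the upper limit of the tails nu_n [t, +oo[. *)

(** * Chevalley's extension theorem *)

Section Chevalley.
Variable L : fieldType.
Implicit Types (R S X : set L).

Definition subring X :=
  [/\ X 1, (forall a b, X a -> X b -> X (a - b)) &
      (forall a b, X a -> X b -> X (a * b))].

Inductive igen S X : L -> Prop :=
| igen0 : igen S X 0
| igenD s r v : S s -> X r -> igen S X v -> igen S X (s * r + v).

Section Subring.
Variable X : set L.
Hypothesis sX : subring X.
Lemma subring1 : X 1. Proof. by case: sX. Qed.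
Lemma subringB a b : X a -> X b -> X (a - b). Proof. by case: sX => _ + _; exact. Qed.
Lemma subringM a b : X a -> X b -> X (a * b). Proof. by case: sX => _ _; exact. Qed.
Lemma subring0 : X 0.
Proof. by rewrite -(subrr 1); apply: subringB; exact: subring1. Qed.
Lemma subringN a : X a -> X (- a).
Proof. by rewrite -sub0r; apply: subringB; exact: subring0. Qed.
Lemma subringD a b : X a -> X b -> X (a + b).
Proof. by move=> Xa Xb; rewrite -(opprK b); apply: subringB => //; exact: subringN. Qed.
Lemma subringX a n : X a -> X (a ^+ n).
Proof.
move=> Xa; elim: n => [|n IH]; first by rewrite expr0; exact: subring1.
by rewrite exprS; apply: subringM.
Qed.
Lemma subring_sum (I : finType) (P : pred I) (F : I -> L) :
  (forall i, P i -> X (F i)) -> X (\sum_(i | P i) F i).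
Proof. by move=> H; elim/big_ind: _ => //; [exact: subring0|exact: subringD]. Qed.

Lemma igen_add S u v : igen S X u -> igen S X v -> igen S X (u + v).
Proof.
move=> + Hv; elim=> [|s r w Ss Xr _ IH]; first by rewrite add0r.
by rewrite -addrA; exact: igenD.
Qed.
Lemma igen_mul S u r : igen S X u -> X r -> igen S X (u * r).
Proof.
move=> + Xr; elim=> [|s t w Ss Xt _ IH]; first by rewrite mul0r; exact: igen0.
by rewrite mulrDl -mulrA; apply: igenD => //; exact: subringM.
Qed.
Lemma igen_gen S s : S s -> igen S X s.
Proof.
by move=> Ss; rewrite -(addr0 s) -{1}(mulr1 s); apply: igenD => //;
  [exact: subring1 | exact: igen0].
Qed.
Lemma igen_subset S : S `<=` X -> igen S X `<=` X.
Proof.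
move=> SX u; elim=> [|s r v Ss Xr _ IH]; first exact: subring0.
by apply: subringD => //; apply: subringM => //; exact: SX.
Qed.
End Subring.

Lemma igen_mono S X Y : X `<=` Y -> igen S X `<=` igen S Y.
Proof.
move=> XY u; elim=> [|s r v Ss Xr _ IH]; first exact: igen0.
by apply: igenD => //; exact: XY.
Qed.

Lemma maximal_subring S R0 : subring R0 -> ~ igen S R0 1 ->
  exists Ov, [/\ subring Ov, R0 `<=` Ov, ~ igen S Ov 1 &
    forall X, subring X -> Ov `<=` X -> ~ igen S X 1 -> X `<=` Ov].
Proof.
move=> sR0 nR0.
pose good X := [/\ subring X, R0 `<=` X & ~ igen S X 1].
(* The union of the empty chain is empty. *)
pose P (X : set L) := X = set0 \/ good X.
have [|A [PA Amax]] := @Zorn_bigcup L P.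
  move=> F FP Ftot.
  have [[X0 FX0 X0n]|Fn] := pselect (exists2 X, F X & X <> set0); last first.
    left; rewrite -subset0 => x [X FX Xx].
    by case: Fn; exists X => // X0; rewrite X0 in Xx.
  have Fgood X : F X -> X <> set0 -> good X by move=> /FP [].
  right; have dir X Y : F X -> F Y -> X <> set0 -> Y <> set0 ->
      exists2 Z, F Z & [/\ Z <> set0, X `<=` Z & Y `<=` Z].
    by move=> FX FY Xn Yn; case: (Ftot _ _ FX FY) => H; [exists Y|exists X] => //; split=> // x Hx.
  have ne X x : X x -> X <> set0 by move=> Xx X_0; rewrite X_0 in Xx.
  split.
  - split.
    + have [sX0 _ _] := Fgood _ FX0 X0n; exists X0; [exact: FX0|exact: subring1].
    + move=> a b [X FX Xa] [Y FY Yb].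
      have [Z FZ [Zn XZ YZ]] := dir _ _ FX FY (ne _ _ Xa) (ne _ _ Yb).
      exists Z => //; have [sZ _ _] := Fgood _ FZ Zn.
      by apply: subringB; [|exact: XZ|exact: YZ].
    + move=> a b [X FX Xa] [Y FY Yb].
      have [Z FZ [Zn XZ YZ]] := dir _ _ FX FY (ne _ _ Xa) (ne _ _ Yb).
      exists Z => //; have [sZ _ _] := Fgood _ FZ Zn.
      by apply: subringM; [|exact: XZ|exact: YZ].
  - move=> x R0x; exists X0 => //.
    by have [_ + _] := Fgood _ FX0 X0n; exact.
  - have H u : igen S (\bigcup_(X in F) X)%classic u ->
        exists2 X, F X & X <> set0 /\ igen S X u.
      elim=> [|s r v Ss [Y FY Yr] _ [X FX [Xn Xv]]].
        by exists X0 => //; split=> //; exact: igen0.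
      have [Z FZ [Zn XZ YZ]] := dir _ _ FX FY Xn (ne _ _ Yr).
      exists Z => //; split=> //; apply: igenD => //; first exact: YZ.
      exact: igen_mono Xv.
    by move=> /H [X FX [Xn X1]]; have [_ _] := Fgood _ FX Xn; exact.
have gA : good A.
  case: PA => // A0; exfalso; apply: (Amax R0); last by right; split.
  by rewrite A0; split=> // /(_ 1 (subring1 sR0)).
case: gA => sA R0A nA; exists A; split=> // X sX AX nX.
apply: contrapT => nXA; apply: (Amax X); first by split.
by right; split=> //; exact: subset_trans AX.
Qed.

Theorem chevalley S R0 : subring R0 -> S `<=` R0 -> ~ igen S R0 1 ->
  exists Ov, [/\ subring Ov, R0 `<=` Ov, (forall x, Ov x \/ Ov x^-1) &
    forall s, S s -> s != 0 -> ~ Ov s^-1].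
Proof.
move=> sR0 SR0 /(maximal_subring sR0) [Ov [sO R0O nO maxO]].
have SO : S `<=` Ov by exact: subset_trans R0O.
have JO := igen_subset sO SO.
exists Ov; split=> //; last first.
  move=> s Ss s0 Os; apply: nO; rewrite -(divff s0).
  by apply: igen_mul => //; exact: igen_gen.
have unit1 j : igen S Ov j -> Ov (1 - j)^-1.
  move=> Jj; have j1 : 1 - j != 0.
    by rewrite subr_eq0; apply/eqP => j1; apply: nO; rewrite j1.
  pose X : set L := [set z | exists n, Ov (z * (1 - j) ^+ n)].
  have O1j : Ov (1 - j) by apply: subringB => //; [exact: subring1|exact: JO].
  have up z n k : Ov (z * (1 - j) ^+ n) -> Ov (z * (1 - j) ^+ (n + k)).
    by move=> Oz; rewrite exprD mulrA; apply: subringM => //; exact: subringX.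
  have sX : subring X.
    split; first by exists 0; rewrite expr0 mulr1; exact: subring1.
    - move=> a b [n Ha] [m Hb]; exists (n + m)%N; rewrite mulrBl.
      by apply: subringB => //; [exact: up|rewrite addnC; exact: up].
    - move=> a b [n Ha] [m Hb]; exists (n + m)%N; rewrite exprD mulrACA.
      exact: subringM.
  apply: (maxO X) => //.
  - by move=> z Oz; exists 0; rewrite expr0 mulr1.
  - have H v : igen S X v -> exists n, igen S Ov (v * (1 - j) ^+ n).
      elim=> [|s r w Ss [n Or] _ [m Jw]]; first by exists 0; rewrite mul0r; exact: igen0.
      exists (n + m)%N; rewrite mulrDl; apply: igen_add.
        by rewrite -mulrA; apply: igen_mul => //; [exact: igen_gen|exact: up].
      by rewrite addnC exprD mulrA; apply: igen_mul => //; exact: subringX.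
    move=> /H [n]; rewrite mul1r => Jn; apply: nO.
    suff J1 : igen S Ov (1 - (1 - j) ^+ n) by rewrite -(subrK ((1 - j) ^+ n) 1); apply: igen_add.
    elim: n {Jn} => [|n IH]; first by rewrite expr0 subrr; exact: igen0.
    rewrite (_ : _ - _ = 1 - (1 - j) ^+ n + j * (1 - j) ^+ n); last by rewrite exprS; ring.
    by apply: igen_add => //; apply: igen_mul => //; exact: subringX.
  - by exists 1%N; rewrite expr1 mulVf //; exact: subring1.
have poly1 x : ~ Ov x -> exists p : {poly L}, (forall i, igen S Ov p`_i) /\ p.[x] = 1.
  move=> nx; pose X : set L := [set z | exists p : {poly L}, (forall i, Ov p`_i) /\ p.[x] = z].
  apply: contrapT => np; apply: nx; apply: (maxO X).
  - split.
    + exists 1; split; last by rewrite hornerC.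
      by move=> i; rewrite coef1; case: eqP => _; [exact: subring1|exact: subring0].
    + move=> _ _ [p [Op <-]] [q [Oq <-]]; exists (p - q); split; last by rewrite hornerD hornerN.
      by move=> i; rewrite coefB; exact: subringB.
    + move=> _ _ [p [Op <-]] [q [Oq <-]]; exists (p * q); split; last by rewrite hornerM.
      by move=> i; rewrite coefM; apply: subring_sum => // j _; exact: subringM.
  - move=> z Oz; exists z%:P; split; last by rewrite hornerC.
    by move=> i; rewrite coefC; case: eqP => _ //; exact: subring0.
  - have H v : igen S X v -> exists p : {poly L}, (forall i, igen S Ov p`_i) /\ p.[x] = v.
      elim=> [|s r w Ss [p [Op <-]] _ [q [Jq <-]]].
        exists 0; rewrite horner0; split=> // i; rewrite coef0; exact: igen0.
      exists (s *: p + q); rewrite hornerD hornerZ; split=> // i.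
      rewrite coefD coefZ; apply: igen_add => //; apply: igen_mul => //; exact: igen_gen.
    by move=> /H.
  - exists 'X; rewrite hornerX; split=> // i; rewrite coefX.
    by case: eqP => _ /=; [exact: subring1|exact: subring0].
have reduce x (p q : {poly L}) : x != 0 ->
    (forall i, igen S Ov p`_i) -> p.[x] = 1 ->
    (forall i, igen S Ov q`_i) -> q.[x^-1] = 1 -> (size q <= size p)%N ->
    exists p' : {poly L}, [/\ forall i, igen S Ov p'`_i, p'.[x] = 1 & (size p' < size p)%N].
  move=> x0 Jp px Jq qx sqp.
  have [n sp] : exists n, size p = n.+1.
    case E : (size p) => [|n]; last by exists n.
    move/eqP: E px; rewrite size_poly_eq0 => /eqP ->; rewrite horner0 => /eqP.
    by rewrite eq_sym oner_eq0.
  have q01 : 1 - q`_0 != 0.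
    by rewrite subr_eq0; apply/eqP => E; apply: nO; rewrite E.
  pose u := (1 - q`_0)^-1.
  have Ou : Ov u by exact: unit1.
  exists (\poly_(i < n) (p`_i + p`_n * u * q`_(n - i))); split.
  - move=> i; rewrite coef_poly; case: ltnP => _; last exact: igen0.
    apply: igen_add => //; apply: igen_mul => //; last exact: JO.
    by apply: igen_mul.
  - rewrite horner_poly.
    under eq_bigr do rewrite mulrDl.
    rewrite big_split /= -px (horner_coef_wide _ (n := n.+1)) ?sp // big_ord_recr /=.
    congr (_ + _).
    under eq_bigr do rewrite -!mulrA; rewrite -!mulr_sumr; congr (_ * _).
    rewrite (_ : \sum_(i < n) _ = x ^+ n * (1 - q`_0)); last first.
      rewrite -qx (@horner_coef_wide _ n.+1); last by rewrite -sp.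
      rewrite big_ord_recl expr0 mulr1 addrC addKr mulr_sumr.
      rewrite (reindex_inj rev_ord_inj) /=; apply: eq_bigr => i _.
      rewrite (subKn (ltn_ord i)) /bump /= add1n expfB_cond; last by rewrite (negbTE x0) add0n.
      by rewrite exprVn mulrCA.
    by rewrite mulrCA mulVf ?mulr1.
  - by rewrite sp ltnS size_poly.
move=> x; have [Ox|nOx] := pselect (Ov x); first by left.
have [Ox|nOx'] := pselect (Ov x^-1); [by right|exfalso].
have x0 : x != 0 by apply/eqP => x0; apply: nOx; rewrite x0; exact: subring0.
have [p [Jp px]] := poly1 _ nOx; have [q [Jq qx]] := poly1 _ nOx'.
have [m] := ubnP (size p + size q)%N; elim: m => // m IH in p Jp px q Jq qx *.
rewrite ltnS => sm.
have [sqp|/ltnW spq] := leqP (size q) (size p).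
  have [p' [Jp' p'x sp']] := reduce x p q x0 Jp px Jq qx sqp.
  by apply: (IH p' Jp' p'x q Jq qx); apply: leq_trans sm; rewrite ltn_add2r.
have xV0 : x^-1 != 0 by rewrite invr_eq0.
have px' : p.[(x^-1)^-1] = 1 by rewrite invrK.
have [q' [Jq' q'x sq']] := reduce x^-1 q p xV0 Jq qx Jp px' spq.
by apply: (IH p Jp px q' Jq' q'x); apply: leq_trans sm; rewrite ltn_add2l.
Qed.

End Chevalley.

(** * Linear algebra and valuations *)

Section KSpan.
Variables (K : fieldType) (L : comNzRingType) (iota : {rmorphism K -> L}).
Implicit Types (G H W : L -> Prop).

Inductive kspan G : L -> Prop :=
| kspan0 : kspan G 0
| kspanD c u v : G u -> kspan G v -> kspan G (iota c * u + v).

Definition ksub W := W 0 /\ forall c u v, W u -> W v -> W (iota c * u + v).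

Lemma ksubD W u v : ksub W -> W u -> W v -> W (u + v).
Proof. by move=> [_ sW] Wu Wv; rewrite -(mul1r u) -(rmorph1 iota); exact: sW. Qed.
Lemma ksubZ W c u : ksub W -> W u -> W (iota c * u).
Proof. by move=> [W0 sW] Wu; rewrite -(addr0 (_ * _)); exact: sW. Qed.
Lemma ksubN W u : ksub W -> W u -> W (- u).
Proof. by move=> sW Wu; rewrite -mulN1r -(rmorphN1 iota); exact: ksubZ. Qed.
Lemma ksubB W u v : ksub W -> W u -> W v -> W (u - v).
Proof. by move=> sW Wu Wv; apply: ksubD => //; exact: ksubN. Qed.
Lemma ksub_sum W (I : finType) (P : pred I) (F : I -> L) : ksub W ->
  (forall i, P i -> W (F i)) -> W (\sum_(i | P i) F i).
Proof.
by move=> sW H; elim/big_ind: _ => //; [case: sW|move=> *; exact: ksubD].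
Qed.

Lemma kspan_least G W : ksub W -> (forall x, G x -> W x) -> forall x, kspan G x -> W x.
Proof. by move=> [W0 sW] GW x; elim=> // c u v /GW Wu _; exact: sW. Qed.

Lemma kspan_gen G x : G x -> kspan G x.
Proof.
move=> Gx; rewrite -(addr0 x) -(mul1r x) -(rmorph1 iota).
by apply: kspanD => //; exact: kspan0.
Qed.

Lemma ksub_kspan G : ksub (kspan G).
Proof.
split; first exact: kspan0.
move=> c u v + Hv; elim=> [|a x y Gx _ IH]; first by rewrite mulr0 add0r.
by rewrite mulrDr -addrA mulrA -rmorphM; exact: kspanD.
Qed.

Lemma kspan_mono G H x : (forall x, G x -> H x) -> kspan G x -> kspan H x.
Proof. by move=> GH; apply: kspan_least; [exact: ksub_kspan|move=> y /GH /kspan_gen]. Qed.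

Lemma kspan_mul G H W x y : ksub W -> (forall x y, G x -> H y -> W (x * y)) ->
  kspan G x -> kspan H y -> W (x * y).
Proof.
move=> sW GHW Gx Hy.
elim: Gx => [|c u v Gu _ IH]; first by rewrite mul0r; case: sW.
rewrite mulrDl -mulrA; apply: sW.2 => //.
elim: Hy {IH} => [|a b w Hb _ IH]; first by rewrite mulr0; case: sW.
by rewrite mulrDr mulrCA; apply: sW.2 => //; exact: GHW.
Qed.

Lemma kspan_seqP (s : seq L) x : kspan (fun y => y \in s) x ->
  exists c : 'I_(size s) -> K, x = \sum_i iota (c i) * s`_i.
Proof.
elim=> [|a u v us _ [c ->]].
  by exists (fun=> 0); rewrite big1 // => i _; rewrite rmorph0 mul0r.
have us' : (index u s < size s)%N by rewrite index_mem.
exists (fun i => (if i == Ordinal us' then a else 0) + c i).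
under [RHS]eq_bigr do rewrite rmorphD mulrDl.
rewrite big_split /=; congr (_ + _).
rewrite (bigD1 (Ordinal us')) //= eqxx nth_index // big1 ?addr0 // => i /negbTE ->.
by rewrite rmorph0 mul0r.
Qed.

Definition kfree (I : finType) (f : I -> L) :=
  forall c : I -> K, \sum_i iota (c i) * f i = 0 -> forall i, c i = 0.

Definition spanned W m :=
  exists2 s : seq L, (size s <= m)%N & forall x, W x -> kspan (fun y => y \in s) x.

Lemma steinitz W m (I : finType) (f : I -> L) :
  spanned W m -> kfree f -> (forall i, W (f i)) -> (#|I| <= m)%N.
Proof.
move=> [s sm Ws] ff Wf; apply: leq_trans sm; rewrite leqNgt; apply/negP => lt.
have /choice [C HC] : forall i, exists c : 'I_(size s) -> K, f i = \sum_j iota (c j) * s`_j.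
  by move=> i; apply: kspan_seqP; exact/Ws/Wf.
pose M : 'M[K]_(#|I|, size s) := \matrix_(i, j) C (enum_val i) j.
have kM : kermx M != 0.
  by rewrite -mxrank_eq0 mxrank_ker subn_eq0 -ltnNge; apply: leq_ltn_trans lt; exact: rank_leq_col.
have /rowV0Pn [v /sub_kermxP vM v0] := kM.
have /ff H : \sum_i iota (v 0 (enum_rank i)) * f i = 0.
  under eq_bigr do rewrite HC mulr_sumr.
  rewrite exchange_big big1 //= => j _.
  under eq_bigr do rewrite mulrA.
  rewrite -mulr_suml.
  rewrite (_ : \sum_(i : I) _ = iota ((v *m M) 0 j)); first by rewrite vM mxE rmorph0 mul0r.
  rewrite mxE rmorph_sum (reindex (@enum_val I predT)) /=; last first.
    by apply: onW_bij; exact: enum_val_bij.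
  by apply: eq_bigr => i _; rewrite enum_valK mxE rmorphM.
case/eqP: v0; apply/rowP => i; rewrite mxE.
by have := H (enum_val i); rewrite enum_valK.
Qed.

End KSpan.

Section Valuation.
Variables (K L : fieldType) (iota : {rmorphism K -> L}) (Ov : set L).
Hypotheses (sO : subring Ov) (KO : forall c, Ov (iota c)) (valO : forall x, Ov x \/ Ov x^-1).

Definition vunit z := [/\ z != 0, Ov z & Ov z^-1].
Definition vmax z := Ov z /\ ~ vunit z.

Lemma vunitM a b : vunit a -> vunit b -> vunit (a * b).
Proof.
move=> [a0 Oa Oa'] [b0 Ob Ob']; split; first by rewrite mulf_neq0.
  exact: subringM.
by rewrite invfM; apply: subringM.
Qed.
Lemma vunitV a : vunit a -> vunit a^-1.
Proof. by move=> [a0 Oa Oa']; split; rewrite ?invr_eq0 ?invrK. Qed.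
Lemma vunit_div a b : vunit a -> vunit b -> vunit (a / b).
Proof. by move=> Ua /vunitV; exact: vunitM. Qed.
Lemma vunitX a n : vunit a -> vunit (a ^+ n).
Proof.
move=> Ua; elim: n => [|n IH]; last by rewrite exprS; exact: vunitM.
by rewrite expr0; split; rewrite ?oner_eq0 ?invr1 //; exact: subring1.
Qed.
Lemma vunit1 : vunit 1. Proof. by rewrite -(expr0 1); apply: vunitX; split; rewrite ?oner_eq0 ?invr1 //; exact: subring1. Qed.
Lemma vunit_const c : c != 0 -> vunit (iota c).
Proof. by move=> c0; split; [rewrite fmorph_eq0| |rewrite -fmorphV]. Qed.

Lemma vmax0 : vmax 0.
Proof. by split; [exact: subring0|case; rewrite eqxx]. Qed.
Lemma vmax1 : ~ vmax 1. Proof. by case=> _; apply; exact: vunit1. Qed.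
Lemma vmaxM a b : Ov a -> vmax b -> vmax (a * b).
Proof.
move=> Oa [Ob nUb]; split; first exact: subringM.
move=> [ab0 _ Oab]; apply: nUb; move: ab0; rewrite mulf_eq0 negb_or => /andP[a0 b0].
by split=> //; rewrite -(mulKf a0 b) invfM mulrC invrK; apply: subringM.
Qed.
Lemma vmaxD a b : vmax a -> vmax b -> vmax (a + b).
Proof.
wlog : a b / b != 0 /\ Ov (a / b).
  move=> H Ma Mb; have [b0|b0] := eqVneq b 0; first by rewrite b0 addr0.
  have [a0|a0] := eqVneq a 0; first by rewrite a0 add0r.
  have [|Ob] := valO (a / b); first by move=> ?; exact: H.
  by rewrite addrC; apply: H => //; split=> //; rewrite -invf_div.
move=> [b0 Oab] _ Mb; rewrite -(divfK b0 a) -{3}(mul1r b) -mulrDl.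
by apply: vmaxM => //; apply: subringD => //; exact: subring1.
Qed.
Lemma vmax_sum (I : finType) (P : pred I) (F : I -> L) :
  (forall i, P i -> vmax (F i)) -> vmax (\sum_(i | P i) F i).
Proof. by move=> H; elim/big_ind: _ => //; [exact: vmax0|exact: vmaxD]. Qed.

Lemma vmin (s : seq L) : s != [::] -> 0 \notin s ->
  exists2 x, x \in s & forall y, y \in s -> Ov (y / x).
Proof.
elim: s => // a s IH _; rewrite inE negb_or eq_sym => /andP[a0 s0].
have [sn|/IH /(_ s0) [x xs Hx]] := eqVneq s [::].
  exists a; first exact: mem_head.
  by move=> y; rewrite sn inE => /eqP ->; rewrite divff //; exact: subring1.
have x0 : x != 0 by apply: contraNneq s0 => <-.
have [Oax|] := valO (a / x).
  exists x; first by rewrite inE xs orbT.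
  by move=> y; rewrite inE => /predU1P[->//|]; exact: Hx.
rewrite invf_div => Oxa; exists a; first exact: mem_head.
move=> y; rewrite inE => /predU1P[->|/Hx Oyx]; first by rewrite divff //; exact: subring1.
by rewrite -(divfK x0 y) -(mulrA (y / x)); exact: subringM.
Qed.

Definition vdistinct (I : finType) (t : I -> L) :=
  forall i j, t i != 0 -> t j != 0 -> vunit (t i / t j) -> i = j.

Lemma vdistinct_sum0 (I : finType) (t : I -> L) : vdistinct t ->
  \sum_i t i = 0 -> forall i, t i = 0.
Proof.
move=> dt t0 i; apply/eqP; apply: contrapT => /negP ti.
pose s := [seq t j | j <- enum I & t j != 0].
have [||x] := @vmin s.
- apply/eqP => /(congr1 (fun s => t i \in s)); rewrite inE => /negP; apply.
  by apply/mapP; exists i => //; rewrite mem_filter ti mem_enum.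
- by apply/mapP => -[j]; rewrite mem_filter => /andP[/eqP tj _] /esym.
move=> /mapP[i0]; rewrite mem_filter => /andP[ti0 _] -> H.
have := erefl (\sum_j t j / t i0); rewrite -{1}mulr_suml t0 mul0r (bigD1 i0) //= divff //.
move/esym/eqP; rewrite addr_eq0 => /eqP E1; apply: vmax1; rewrite E1.
rewrite -sumrN; apply: vmax_sum => j ji0; rewrite -mulN1r; apply: vmaxM.
  by apply: subringN => //; exact: subring1.
have [->|tj] := eqVneq (t j) 0; first by rewrite mul0r; exact: vmax0.
split; first by apply/H/mapP; exists j => //; rewrite mem_filter tj mem_enum.
by move=> /(dt _ _ tj ti0) /eqP; rewrite (negbTE ji0).
Qed.

(* c_1, .., c_r have the value of g and residues c_j / g linearly independent over K. *)
Definition residue_free g r (c : 'I_r -> L) :=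
  forall a : 'I_r -> K, (exists j, a j != 0) -> vunit ((\sum_j iota (a j) * c j) / g).

Lemma kfree_vdistinct (I : finType) (t : I -> L) g r (c : 'I_r -> L) :
  g != 0 -> (forall i, t i != 0) -> vdistinct t -> residue_free g c ->
  kfree iota (fun p : I * 'I_r => t p.1 * c p.2).
Proof.
move=> g0 t0 dt rc a Ha.
pose C i := \sum_j iota (a (i, j)) * c j.
have C0 i : C i = 0 -> forall j, a (i, j) = 0.
  move=> Ci j; apply/eqP; apply: contrapT => /negP aij.
  have := rc (fun j => a (i, j)) (ex_intro _ j aij).
  by rewrite -/(C i) Ci mul0r => -[]; rewrite eqxx.
have Cu i : C i != 0 -> vunit (C i / g).
  move=> Ci; apply: rc; apply: contrapT => na; case/eqP: Ci; rewrite /C big1 // => j _.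
  have [->|aij] := eqVneq (a (i, j)) 0; first by rewrite rmorph0 mul0r.
  by case: na; exists j.
suff H i : t i * C i = 0.
  case=> i j; apply: C0; apply/eqP; have /eqP := H i.
  by rewrite mulf_eq0 (negbTE (t0 i)).
move: i; apply: vdistinct_sum0.
  move=> i j; rewrite !mulf_eq0 !negb_or => /andP[ti Ci] /andP[tj Cj] U.
  apply: dt => //.
  rewrite (_ : _ / _ = t i * C i / (t j * C j) * (C j / g) / (C i / g)).
    by apply: vunit_div; [apply: vunitM => //|]; exact: Cu.
  by field; rewrite tj g0 Ci Cj.
transitivity (\sum_i \sum_j iota (a (i, j)) * (t i * c j)).
  by apply: eq_bigr => i _; rewrite mulr_sumr; apply: eq_bigr => j _; rewrite mulrCA.
by rewrite (pair_bigA _ (fun i j => iota (a (i, j)) * (t i * c j))) -[RHS]Ha; apply: eq_bigr => -[].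
Qed.

Lemma spanned_values kappa n (ws : seq L) (W : L -> Prop) : (size ws <= n)%N -> ksub iota W ->
  0 \notin ws -> (forall x, x \in ws -> W x) ->
  (forall w, W w -> w != 0 -> exists2 x, x \in ws & vunit (w / x)) ->
  (forall g r (c : 'I_r -> L), g != 0 -> W g -> (forall i, W (c i)) -> residue_free g c ->
     (r <= kappa)%N) ->
  spanned iota W (kappa * size ws).
Proof.
elim: n ws W => [|n IH] ws W sn sW ws0 wsW Wws hk.
  move: sn Wws; rewrite leqn0 size_eq0 => /eqP -> Wws; exists [::] => // x Wx.
  have [->|/(Wws _ Wx) []//] := eqVneq x 0; exact: kspan0.
have [wsn|wsn] := eqVneq ws [::]; first by apply: IH => //; rewrite wsn.
have [g gws Hg] := vmin wsn ws0.
have g0 : g != 0 by apply: contraNneq ws0 => <-.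
have OW w : W w -> Ov (w / g).
  move=> Ww; have [->|w0] := eqVneq w 0; first by rewrite mul0r; exact: subring0.
  have [x xs [_ Owx _]] := Wws _ Ww w0.
  have x0 : x != 0 by apply: contraNneq ws0 => <-.
  by rewrite -(divfK x0 w) -(mulrA (w / x)); apply: subringM => //; exact: Hg.
pose W' w := W w /\ vmax (w / g).
pose ws' := [seq x <- ws | `[< vmax (x / g) >]].
have sws' : (size ws' < size ws)%N.
  rewrite size_filter -(count_predC (fun x => `[< vmax (x / g) >]) ws) -[X in (X < _)%N]addn0 ltn_add2l.
  rewrite -has_count; apply/hasP; exists g => //=; apply/asboolPn; rewrite divff //; exact: vmax1.
have sW' : ksub iota W'.
  split; first by split; [case: sW|rewrite mul0r; exact: vmax0].
  move=> c u v [Wu Mu] [Wv Mv]; split; first exact: sW.2.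
  by rewrite mulrDl -mulrA; apply: vmaxD => //; exact: vmaxM.
have [] := IH ws' W'; rewrite //.
- by rewrite -ltnS; apply: leq_trans sws' sn.
- by rewrite mem_filter (negbTE ws0) andbF.
- by move=> x; rewrite mem_filter => /andP[/asboolP Mx /wsW].
- move=> w [Ww Mw] w0; have [x xs Ux] := Wws _ Ww w0; exists x => //.
  have x0 : x != 0 by apply: contraNneq ws0 => <-.
  rewrite mem_filter xs andbT; apply/asboolP.
  rewrite (_ : x / g = (w / x)^-1 * (w / g)); first by apply: vmaxM => //; case: Ux.
  by field; rewrite w0 g0 x0.
- by move=> h r c h0 [Wh _] Wc; apply: hk => // i; case: (Wc i).
move=> s' ss' Ws'.
pose P r := `[< exists c : 'I_r -> L, (forall i, W (c i)) /\ residue_free g c >].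
have P0 : exists r, P r by exists 0; apply/asboolP; exists (fun=> 0); split=> [[]//|a [[]]].
have Pk r : P r -> (r <= kappa)%N.
  by move=> /asboolP [c [Wc rc]]; exact: (hk g _ c g0 (wsW _ gws) Wc rc).
case: (ex_maxnP P0 Pk) => r /asboolP [c [Wc rc]] rmax.
exists (s' ++ [seq c j | j <- enum 'I_r]).
  rewrite size_cat size_map size_enum_ord.
  apply: (leq_trans (leq_add ss' (Pk r _))); first by apply/asboolP; exists c.
  by rewrite -mulnSr leq_mul2l sws' orbT.
move=> w Ww.
pose c' (i : 'I_r.+1) := oapp c w (unlift ord0 i).
have Wc' i : W (c' i) by rewrite /c'; case: (unlift ord0 i).
have : ~ residue_free g c'.
  move=> rc'; suff /rmax : P r.+1 by rewrite ltnn.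
  by apply/asboolP; exists c'.
move=> /existsNP [a] /not_implyP [an nU].
have Ea : \sum_j iota (a j) * c' j = iota (a ord0) * w + \sum_j iota (a (lift ord0 j)) * c j.
  rewrite big_ord_recl /c' unlift_none; congr (_ + _); apply: eq_bigr => i _.
  by rewrite liftK.
have Mz : vmax ((\sum_j iota (a j) * c' j) / g).
  split=> //; apply: OW; apply: (ksub_sum sW) => i _; exact: (ksubZ _ sW (Wc' i)).
have a0 : a ord0 != 0.
  apply/eqP => a0; case: nU; rewrite Ea a0 rmorph0 mul0r add0r; apply: rc.
  case: an => j; case: (unliftP ord0 j) => [i ->|->]; last by rewrite a0 eqxx.
  by exists i.
have W'z : W' (iota (a ord0)^-1 * \sum_j iota (a j) * c' j).
  split; last by rewrite -mulrA; apply: vmaxM.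
  by apply: (ksubZ _ sW); apply: (ksub_sum sW) => i _; exact: (ksubZ _ sW (Wc' i)).
have -> : w = iota (a ord0)^-1 * (\sum_j iota (a j) * c' j)
    - iota (a ord0)^-1 * \sum_j iota (a (lift ord0 j)) * c j.
  by rewrite Ea mulrDr addrK mulrA -rmorphM mulVf // rmorph1 mul1r.
apply: ksubB; first exact: ksub_kspan.
  by apply: kspan_mono (Ws' _ W'z) => x; rewrite mem_cat => ->.
apply: ksubZ; first exact: ksub_kspan.
apply: ksub_sum => [|j _]; first exact: ksub_kspan.
apply: ksubZ; first exact: ksub_kspan.
by apply: kspan_gen; rewrite mem_cat; apply/orP; right; apply: map_f; rewrite mem_enum.
Qed.

Lemma values_seq m (W : L -> Prop) :
  (forall (I : finType) (f : I -> L), kfree iota f -> (forall i, W (f i)) -> (#|I| <= m)%N) ->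
  exists ws : seq L, [/\ 0 \notin ws, (forall x, x \in ws -> W x),
    (forall w, W w -> w != 0 -> exists2 x, x \in ws & vunit (w / x)) &
    vdistinct (fun i : 'I_(size ws) => ws`_i)].
Proof.
move=> sm.
pose P r := `[< exists ws : seq L, [/\ size ws = r, 0 \notin ws, (forall x, x \in ws -> W x) &
    vdistinct (fun i : 'I_(size ws) => ws`_i)] >].
have P0 : exists r, P r by exists 0; apply/asboolP; exists [::]; split=> // -[].
have rc1 : residue_free 1 (fun _ : 'I_1 => 1).
  move=> a [j aj]; rewrite big_ord1 mulr1 divr1; rewrite (ord1 j) in aj; exact: vunit_const.
have Pk r : P r -> (r <= m)%N.
  move=> /asboolP [ws [sws ws0 wsW dws]].
  have ws0' (i : 'I_(size ws)) : ws`_i != 0 by apply: contraNneq ws0 => <-; exact: mem_nth.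
  have := sm _ _ (kfree_vdistinct (oner_neq0 _) ws0' dws rc1).
  rewrite card_prod !card_ord muln1 sws; apply => -[i j] /=.
  by rewrite mulr1; apply: wsW; apply: mem_nth; rewrite sws.
case: (ex_maxnP P0 Pk) => r /asboolP [ws [sws ws0 wsW dws]] rmax; exists ws; split=> //.
move=> w Ww w0; apply: contrapT => nw.
suff /rmax : P r.+1 by rewrite ltnn.
apply/asboolP; exists (w :: ws); split.
- by rewrite /= sws.
- by rewrite inE negb_or eq_sym w0.
- by move=> x; rewrite inE => /predU1P[->//|/wsW].
have nw' x : x \in ws -> ~ vunit (w / x) by move=> xs Ux; apply: nw; exists x.
move=> i j; case: (unliftP ord0 i) => [i' ->|->]; case: (unliftP ord0 j) => [j' ->|->] //=.
- by rewrite !add0n => h1 h2 h3; congr lift; exact: dws.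
- by rewrite add0n => h1 h2 /vunitV; rewrite invf_div => /nw' []; exact: mem_nth.
- by rewrite add0n => h1 h2 /nw' []; exact: mem_nth.
Qed.

End Valuation.

(** * Algebraic independence and growth *)

Section Monomials.
Variables (K L : fieldType) (iota : {rmorphism K -> L}).

Definition mon d (y : 'I_d -> L) (b : 'I_d -> nat) := \prod_i y i ^+ b i.
Definition addexp d (a b : 'I_d -> nat) := fun i => (a i + b i)%N.

Lemma monD d (y : 'I_d -> L) a b : mon y (addexp a b) = mon y a * mon y b.
Proof. by rewrite /mon -big_split; apply: eq_bigr => i _; rewrite exprD. Qed.

Lemma monX d (y : 'I_d -> L) a k : mon y (fun i => k * a i)%N = mon y a ^+ k.
Proof. by rewrite /mon -prodrXl; apply: eq_bigr => i _; rewrite mulnC exprM. Qed.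

Lemma mon0 d (y : 'I_d -> L) : mon y (fun=> 0%N) = 1.
Proof. by rewrite /mon big1 // => i _; rewrite expr0. Qed.

Definition alg_indep d (y : 'I_d -> L) := forall b : 'I_d -> nat,
  ~ kspan iota (fun z => exists a : 'I_d -> nat, a <> b /\ z = mon y a) (mon y b).

Definition box d (y : 'I_d -> L) n :=
  kspan iota (fun z => exists b : 'I_d -> nat, (forall i, (b i <= n)%N) /\ z = mon y b).

Lemma ksub_box d (y : 'I_d -> L) n : ksub iota (box y n).
Proof. exact: ksub_kspan. Qed.

Lemma box_mono d (y : 'I_d -> L) n m z : (n <= m)%N -> box y n z -> box y m z.
Proof.
move=> nm; apply: kspan_mono => x [b [bn ->]]; exists b; split=> // i.
exact: leq_trans nm.
Qed.

Lemma box_mul d (y : 'I_d -> L) n m a b : box y n a -> box y m b -> box y (n + m) (a * b).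
Proof.
apply: kspan_mul => [|x z [b1 [b1n ->]] [b2 [b2n ->]]]; first exact: ksub_kspan.
apply: kspan_gen; exists (addexp b1 b2); rewrite monD; split=> // i.
exact: leq_add.
Qed.

Lemma box1 d (y : 'I_d -> L) n : box y n 1.
Proof. by apply: kspan_gen; exists (fun=> 0%N); rewrite mon0. Qed.

Lemma box_spanned d (y : 'I_d -> L) n : spanned iota (box y n) (n.+1 ^ d).
Proof.
exists [seq mon y (fun i => (b : {ffun 'I_d -> 'I_n.+1}) i) | b <- enum {ffun 'I_d -> 'I_n.+1}].
  by rewrite size_map -cardE card_ffun !card_ord.
move=> z; apply: kspan_mono => x [b [bn ->]]; apply/mapP.
exists [ffun i => inord (b i)]; first by rewrite mem_enum.
by apply: eq_bigr => i _; rewrite ffunE inordK // ltnS.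
Qed.

Definition consv d (u : L) (y : 'I_d -> L) (i : 'I_d.+1) := oapp y u (unlift ord0 i).

Lemma mon_cons d u (y : 'I_d -> L) b :
  mon (consv u y) b = u ^+ b ord0 * mon y (fun i => b (lift ord0 i)).
Proof.
rewrite /mon big_ord_recl /consv unlift_none; congr (_ * _).
by apply: eq_bigr => i _; rewrite liftK.
Qed.

Definition algrel d (y : 'I_d -> L) u := exists (q : {poly L}) n,
  [/\ q != 0, forall i, box y n q`_i & root q u].

Lemma algrel_cons d (y : 'I_d -> L) u v : algrel y u -> algrel (consv v y) u.
Proof.
move=> [q [n [q0 bq qu]]]; exists q, n; split=> // i.
apply: kspan_mono (bq i) => z [b [bn ->]].
exists (fun i => oapp b 0%N (unlift ord0 i)); split.
  by move=> j; case: (unlift ord0 j) => //=.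
rewrite mon_cons unlift_none expr0 mul1r; apply: eq_bigr => j _; by rewrite liftK.
Qed.

Lemma algrel_self d (y : 'I_d -> L) v : algrel (consv v y) v.
Proof.
exists ('X - v%:P), 1%N; split; rewrite ?polyXsubC_eq0 ?root_XsubC // => i.
rewrite coefB coefX coefC; apply: ksubB; first exact: ksub_box.
  by case: eqP => _; [exact: box1|case: (ksub_box (consv v y) 1)].
case: eqP => _; last by case: (ksub_box (consv v y) 1).
apply: kspan_gen; exists (fun i => oapp (fun=> 0%N) 1%N (unlift ord0 i)); split.
  by move=> j; case: (unlift ord0 j).
rewrite mon_cons unlift_none expr1 (_ : mon _ _ = 1) ?mulr1 // -(mon0 y).
by apply: eq_bigr => j _; rewrite liftK.
Qed.

Lemma alg_indep_cons d (y : 'I_d -> L) u : alg_indep y ->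
  alg_indep (consv u y) \/ algrel y u.
Proof.
move=> ay; have [|/existsNP [b /contrapT]] := pselect (alg_indep (consv u y)); first by left.
move=> H; right.
pose b' := fun i => b (lift ord0 i).
have {H} : exists (p : {poly L}) n, [/\ p.[u] = mon (consv u y) b, forall i, box y n p`_i &
    kspan iota (fun z => exists a : 'I_d -> nat, a <> b' /\ z = mon y a) p`_(b ord0)].
  elim: H => [|c _ v [a [ab ->]] _ [p [n [<- bp sp]]]].
    by exists 0, 0%N; rewrite horner0; split=> // [i|]; rewrite coef0; exact: kspan0.
  pose a' := fun i => a (lift ord0 i).
  exists ((iota c * mon y a') *: 'X^(a ord0) + p), (maxn n (\max_i a' i)); split.
  - by rewrite hornerD hornerZ hornerXn mon_cons -/a'; congr (_ + _); ring.
  - move=> i; rewrite coefD coefZ coefXn; apply: ksubD; first exact: ksub_box.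
      rewrite -mulrA; apply: (ksubZ _ (ksub_box _ _)).
      case: eqP => _; last by rewrite mulr0; case: (ksub_box y (maxn n (\max_i a' i))).
      rewrite mulr1; apply: kspan_gen; exists a'; split=> // j.
      by apply: leq_trans (leq_maxr _ _); exact: leq_bigmax.
    exact: box_mono (leq_maxl _ _) (bp i).
  - rewrite coefD coefZ coefXn; apply: ksubD => //; first exact: ksub_kspan.
    rewrite -mulrA; apply: (ksubZ _ (ksub_kspan _ _)).
    case: eqP => [E|_]; last by rewrite mulr0; exact: kspan0.
    rewrite mulr1; apply: kspan_gen; exists a'; split=> // a'b'; apply: ab; apply/funext => i.
    by case: (unliftP ord0 i) => [j ->|->]; [exact: (congr1 (fun g => g j) a'b')|].
move=> [p [n [pu bp sp]]].
exists (mon y b' *: 'X^(b ord0) - p), (maxn n (\max_i b' i)); split.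
- apply/eqP => /(congr1 (fun q : {poly L} => q`_(b ord0))).
  rewrite coefB coefZ coefXn eqxx mulr1 coef0 => /eqP; rewrite subr_eq0 => /eqP E.
  by apply: (ay b'); rewrite E.
- move=> i; rewrite coefB coefZ coefXn; apply: ksubB; first exact: ksub_box.
    case: eqP => _; last by rewrite mulr0; case: (ksub_box y (maxn n (\max_i b' i))).
    rewrite mulr1; apply: kspan_gen; exists b'; split=> // j.
    by apply: leq_trans (leq_maxr _ _); exact: leq_bigmax.
  exact: box_mono (leq_maxl _ _) (bp i).
- by rewrite rootE hornerD hornerN hornerZ hornerXn pu mon_cons mulrC subrr.
Qed.

Lemma exists_alg_indep (l : seq L) : exists d (y : 'I_d -> L),
  [/\ alg_indep y, forall i, y i \in l & forall u, u \in l -> algrel y u].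
Proof.
elim: l => [|u l [d [y [ay yl rl]]]].
  exists 0%N, (fun=> 0); split=> [b H||//]; last by case.
  suff : mon (fun _ : 'I_0 => 0 : L) b = 0 by rewrite /mon big_ord0 => /eqP; rewrite oner_eq0.
  by elim: H => // c v w [a [ab _]]; case: ab; apply/funext; case.
have [ayu|ru] := alg_indep_cons u ay.
  exists d.+1, (consv u y); split=> //.
    by move=> i; rewrite /consv; case: (unlift ord0 i) => [j|] /=; rewrite inE ?eqxx // yl orbT.
  by move=> v; rewrite inE => /predU1P[->|/rl]; [exact: algrel_self|exact: algrel_cons].
exists d, y; split=> // [i|v]; first by rewrite inE yl orbT.
by rewrite inE => /predU1P[->//|/rl].
Qed.

Section Growth.
Variables (d : nat) (y : 'I_d -> L).

Fixpoint redspan (l : seq (L * nat)) n : L -> Prop :=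
  if l is (u, e) :: l' then fun z => exists s : nat -> L,
    (forall i, redspan l' n (s i)) /\ z = \sum_(i < e) u ^+ i * s i
  else box y n.

Lemma ksub_redspan l n : ksub iota (redspan l n).
Proof.
elim: l => [|[u e] l [IH0 IH]] /=; first exact: ksub_box.
split; first by exists (fun=> 0); split=> //; rewrite big1 // => i _; rewrite mulr0.
move=> c _ _ [s [Hs ->]] [t [Ht ->]]; exists (fun i => iota c * s i + t i).
split; first by move=> i; exact: IH.
rewrite mulr_sumr -big_split; apply: eq_bigr => i _ /=; ring.
Qed.

Lemma box_redspan l n m a b : box y n a -> redspan l m b -> redspan l (m + n) (a * b).
Proof.
move=> ba; elim: l b => [|[u e] l IH] b /=; first by rewrite addnC; exact: box_mul.
move=> [s [Hs ->]]; exists (fun i => a * s i); split=> [i|]; first exact: IH.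
by rewrite mulr_sumr; apply: eq_bigr => i _; rewrite mulrCA.
Qed.

Lemma redspan1 l : all (fun ue => (0 < ue.2)%N) l -> redspan l 0 1.
Proof.
elim: l => [_|[u [|e]] l IH //= Hl]; first exact: box1.
exists (fun i => if i is 0%N then 1 else 0); split.
  by case=> [|i]; [exact: IH|case: (ksub_redspan l 0)].
by rewrite big_ord_recl expr0 mulr1 big1 ?addr0 // => i _; rewrite mulr0.
Qed.

Lemma redspan_spanned l n :
  spanned iota (redspan l n) ((\prod_(ue <- l) ue.2) * n.+1 ^ d).
Proof.
elim: l => [|[u e] l [s ss Hs]] /=; first by rewrite big_nil mul1n; exact: box_spanned.
exists [seq u ^+ i * x | i <- seq.iota 0 e, x <- s].
  by rewrite size_allpairs size_iota big_cons -mulnA leq_mul.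
move=> _ [t [Ht ->]]; apply: ksub_sum => [|i _]; first exact: ksub_kspan.

have := Hs _ (Ht i); elim=> [|c v w vs _ IH]; first by rewrite mulr0; exact: kspan0.
rewrite mulrDr mulrCA; apply: kspanD => //.
by apply: allpairs_f => //; rewrite mem_iota /=.
Qed.

(* Multiplication by c lets one exponent overflow: u^e is then rewritten by the relation. *)
Lemma redspan_step (l : seq (L * nat)) :
  (forall ue, ue \in l -> exists c n (a : nat -> L), [/\ c != 0, box y n c,
     forall i, box y n (a i) & c * ue.1 ^+ ue.2 = \sum_(i < ue.2) a i * ue.1 ^+ i]) ->
  exists c m, [/\ c != 0, box y m c &
    forall ue, ue \in l -> forall n s, redspan l n s -> redspan l (n + m) (c * ue.1 * s)].
Proof.
elim: l => [|[u e] l IH] Hl; first by exists 1, 0%N; rewrite oner_eq0; split=> //; exact: box1.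
have [|c [m [c0 bc Hc]]] := IH; first by move=> ue uel; apply: Hl; rewrite inE uel orbT.
have [c' [m' [a [c'0 bc' ba /= Ea]]]] := Hl (u, e) (mem_head _ _).
exists (c * c'), (m' + m)%N; split; first by rewrite mulf_neq0.
  by rewrite addnC; exact: box_mul.
move=> [v e'] vl n _ [s [Hs ->]] /=.
have [[-> _]|vnu] := eqVneq (v, e') (u, e).
  case: e Ea Hs {Hl vl} => [|e] Ea Hs.
    by move: Ea; rewrite expr0 mulr1 big_ord0 => /eqP; rewrite (negbTE c'0).
  exists (fun i => c * ((if i is j.+1 then c' * s j else 0) + a i * s e)); split.
    move=> i; rewrite addnA; apply: box_redspan => //; apply: ksubD; first exact: ksub_redspan.
      by case: i => [|i]; [case: (ksub_redspan l (n + m'))|exact: box_redspan].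
    exact: box_redspan.
  rewrite big_ord_recr /= mulrDr.
  have -> : c * c' * u * (u ^+ e * s e) = c * s e * (c' * u ^+ e.+1) by rewrite exprS; ring.
  rewrite Ea.
  have -> : c * c' * u * (\sum_(i < e) u ^+ i * s i) =
      \sum_(i < e.+1) u ^+ i * (c * (if val i is j.+1 then c' * s j else 0)).
    rewrite big_ord_recl /= !mulr0 add0r mulr_sumr; apply: eq_bigr => i _.
    by rewrite /bump /= add1n exprS; ring.
  by rewrite mulr_sumr -big_split; apply: eq_bigr => i _ /=; ring.
have {}vl : (v, e') \in l by move: vl; rewrite inE (negbTE vnu).
exists (fun i => c' * (c * v * s i)); split.
  move=> i; rewrite (addnC m') addnA; apply: box_redspan => //; exact: (Hc _ vl).
by rewrite mulr_sumr; apply: eq_bigr => i _; ring.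
Qed.

Lemma algrel_top u : algrel y u -> exists (e : nat) c n (a : nat -> L), [/\ (0 < e)%N, c != 0, box y n c,
   forall i, box y n (a i) & c * u ^+ e = \sum_(i < e) a i * u ^+ i].
Proof.
move=> [q [n [q0 bq qu]]]; exists (size q).-1, (lead_coef q), n, (fun i => - q`_i); split.
- by have := root_size_gt1 q0 qu; case: (size q) => [|[]].
- by rewrite lead_coef_eq0.
- exact: bq.
- by move=> i; apply: (ksubN (ksub_box _ _)).
have := qu; rewrite rootE horner_coef; have := root_size_gt1 q0 qu; rewrite lead_coefE.
case: (size q) => // k _; rewrite big_ord_recr /= addrC addr_eq0 => /eqP ->.
by rewrite -sumrN; apply: eq_bigr => i _; rewrite mulNr.
Qed.

Lemma growth (V : nat -> L -> Prop) (gens : seq L) :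
  (forall u, u \in gens -> algrel y u) ->
  (forall n z, V n z -> kspan iota (fun x => exists t : seq L,
     [/\ size t = n, all (mem gens) t & x = \prod_(u <- t) u]) z) ->
  exists C, forall n (I : finType) (f : I -> L), kfree iota f -> (forall i, V n (f i)) ->
    (#|I| <= C * n.+1 ^ d)%N.
Proof.
move=> rg HV.
have /choice [e He] : forall u, exists e : nat, u \in gens -> exists c n (a : nat -> L),
   [/\ (0 < e)%N, c != 0, box y n c, forall i, box y n (a i) &
       c * u ^+ e = \sum_(i < e) a i * u ^+ i].
  move=> u; case: (boolP (u \in gens)) => [/rg/algrel_top [e He]|_]; last by exists 0%N.
  by exists e.
pose l := [seq (u, e u) | u <- gens].
have [|c [m [c0 bc Hc]]] := @redspan_step l.
  move=> _ /mapP[u ug ->] /=; have [c [n [a [_ H1 H2 H3 H4]]]] := He _ ug.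
  by exists c, n, a.
have l0 : all (fun ue => (0 < ue.2)%N) l.
  by apply/allP => _ /mapP[u ug ->] /=; have [? [? [? []]]] := He _ ug.
have step t : all (mem gens) t -> redspan l (size t * m) (c ^+ size t * \prod_(u <- t) u).
  elim: t => [|u t IH]; first by rewrite big_nil expr0 mulr1 mul0n => _; exact: redspan1.
  move=> /= /andP[ug /IH Ht]; rewrite big_cons mulSn addnC exprS.
  rewrite (_ : _ * _ = c * u * (c ^+ size t * \prod_(u <- t) u)); last by ring.
  by apply: (Hc (u, e u)) => //; exact: map_f.
exists ((\prod_(ue <- l) ue.2) * m.+1 ^ d)%N => n I f ff Vf.
have fc : kfree iota (fun i => c ^+ n * f i).
  move=> a Ha; apply: ff; apply: (mulfI (expf_neq0 n c0)); rewrite mulr0 -[RHS]Ha mulr_sumr.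
  by apply: eq_bigr => i _; ring.
have := steinitz (redspan_spanned l (n * m)) fc.
move=> H; apply: leq_trans (H _) _.
  move=> i; have := HV _ _ (Vf i).
  elim=> [|a u v [t [st tg ->]] _ IH]; first by rewrite mulr0; case: (ksub_redspan l (n * m)).
  by rewrite mulrDr mulrCA; apply: (ksub_redspan _ _).2 => //; rewrite -st; exact: step.
rewrite -mulnA leq_mul2l -expnMn; apply/orP; right.
by case: (posnP d) => [->//|d0]; rewrite leq_exp2r //; lia.
Qed.

End Growth.
End Monomials.

(** * Powers in a filtered field *)

Section MonomialValuation.
Variables (K L : fieldType) (iota : {rmorphism K -> L}).
Variables (d : nat) (y : 'I_d -> L).
Hypothesis ay : alg_indep iota y.

Definition lexlt (b a : 'I_d -> nat) :=
  exists i, (b i < a i)%N /\ forall j : 'I_d, (j < i)%N -> b j = a j.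

Lemma lexlt_irr a : ~ lexlt a a.
Proof. by move=> [i []]; rewrite ltnn. Qed.

Lemma lexlt_total a b : a <> b -> lexlt a b \/ lexlt b a.
Proof.
move=> ab; have : exists i, a i != b i.
  apply: contrapT => H; apply: ab; apply/funext => i; apply/eqP.
  by apply: contrapT => /negP abi; apply: H; exists i.
move=> [i0 Hi0]; pose i := [arg min_(i < i0 | a i != b i) (i : nat)].
have [abi imin] : a i != b i /\ forall j, a j != b j -> (i <= j)%N.
  by rewrite /i; case: arg_minnP.
have eq (j : 'I_d) : (j < i)%N -> a j = b j.
  by move=> ji; apply/eqP; apply: contraLR ji => /imin; rewrite -leqNgt.
case: (ltngtP (a i) (b i)) abi => // ? _; [left|right]; exists i; split=> // j /eq.
by move=> ->.
Qed.

Lemma lexlt_add a b c : lexlt a b -> lexlt (addexp c a) (addexp c b).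
Proof.
move=> [i [abi H]]; exists i; rewrite ltn_add2l; split=> // j ji.
by rewrite /addexp H.
Qed.

Lemma lexlt_addr a b c : lexlt a b -> lexlt (addexp a c) (addexp b c).
Proof.
move=> [i [abi H]]; exists i; rewrite ltn_add2r; split=> // j ji.
by rewrite /addexp H.
Qed.

Lemma lexlt_add2 a b a' b' : lexlt a b -> lexlt a' b' -> lexlt (addexp a a') (addexp b b').
Proof.
move=> [i [abi H]] [i' [abi' H']].
rewrite /lexlt /addexp; case: (ltngtP i i') => ii'.
- exists i; rewrite H' // ltn_add2r; split=> // j ji; rewrite H ?H' //; exact: ltn_trans ii'.
- exists i'; rewrite H // ltn_add2l; split=> // j ji; rewrite H ?H' //; exact: ltn_trans ii'.
- exists i; have E : i = i' by exact: val_inj.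
  rewrite -E in abi' H'; split; first by rewrite -addSn leq_add // ltnW.
  by move=> j ji; rewrite H // H'.
Qed.

Lemma mon_neq0 b : mon y b != 0.
Proof. by apply/eqP => b0; apply: (ay (b := b)); rewrite b0; exact: kspan0. Qed.

Theorem monomial_valuation : exists Ov : set L,
  [/\ subring Ov, forall c, Ov (iota c), forall x, Ov x \/ Ov x^-1 &
    forall a b, vunit Ov (mon y a / mon y b) -> a = b].
Proof.
pose S : set L := [set z | exists a b, lexlt b a /\ z = mon y a / mon y b].
have S0 z : S z -> z != 0.
  by move=> [a [b [_ ->]]]; rewrite mulf_neq0 ?invr_eq0 ?mon_neq0.
have SM x z : S x -> S z -> S (x * z).
  move=> [a [b [ab ->]]] [a' [b' [ab' ->]]]; exists (addexp a a'), (addexp b b').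
  split; first exact: lexlt_add2.
  by rewrite !monD; field; rewrite !mon_neq0.
pose R0 : set L := [set z | exists c, kspan iota S (z - iota c)].
have sS := ksub_kspan iota S.
have sSM x z : kspan iota S x -> kspan iota S z -> kspan iota S (x * z).
  by apply: kspan_mul => // u v Su Sv; apply: kspan_gen; exact: SM.
have sR0 : subring R0.
  split; first by exists 1; rewrite rmorph1 subrr; exact: kspan0.
  - move=> a b [c Ha] [c' Hb]; exists (c - c').
    by rewrite (_ : _ - _ = (a - iota c) - (b - iota c')); [exact: (ksubB sS)|rewrite rmorphB; ring].
  - move=> a b [c Ha] [c' Hb]; exists (c * c').
    rewrite (_ : _ - _ = (a - iota c) * (b - iota c') + (iota c * (b - iota c') + iota c' * (a - iota c))); last by rewrite rmorphM; ring.
    by apply: (ksubD sS); [exact: sSM|apply: (ksubD sS); exact: (ksubZ _ sS)].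
have SR0 : S `<=` R0 by move=> z Sz; exists 0; rewrite rmorph0 subr0; exact: kspan_gen.
have nR0 : ~ igen S R0 1.
  have H1 z : igen S R0 z -> kspan iota S z.
    elim=> [|s r v Ss [c Hr] _ IH]; first exact: kspan0.
    apply: (ksubD sS) => //; rewrite -(subrK (iota c) r) mulrDr; apply: (ksubD sS).
      by apply: sSM => //; exact: kspan_gen.
    by rewrite mulrC; apply: (ksubZ _ sS); exact: kspan_gen.
  have H2 z : kspan iota S z -> exists b,
      kspan iota (fun x => exists a, lexlt b a /\ x = mon y a) (z * mon y b).
    elim=> [|c u v [a [b [ab ->]]] _ [b' Hb']].
      by exists (fun=> 0%N); rewrite mul0r; exact: kspan0.
    exists (addexp b b'); rewrite mulrDl.
    apply: ksubD; first exact: ksub_kspan.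
      have -> : iota c * (mon y a / mon y b) * mon y (addexp b b') = iota c * mon y (addexp a b').
        by rewrite !monD; field; rewrite mon_neq0.
      apply: (ksubZ _ (ksub_kspan _ _)); apply: kspan_gen; exists (addexp a b'); split=> //.
      exact: lexlt_addr.
    rewrite monD mulrC -mulrA [_ * v]mulrC.
    elim: Hb' => [|c' u' v' [a' [ba' ->]] _ IH]; first by rewrite mulr0; exact: kspan0.
    rewrite mulrDr mulrCA; apply: kspanD => //.
    by exists (addexp b a'); rewrite monD; split=> //; exact: lexlt_add.
  move=> /H1 /H2 [b]; rewrite mul1r => Hb; apply: (ay (b := b)).
  apply: kspan_mono Hb => x [a [ba ->]]; exists a; split=> // ab.
  by move: ba; rewrite ab; exact: lexlt_irr.
have [Ov [sO R0O valO SO]] := chevalley sR0 SR0 nR0.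
exists Ov; split=> //.
  by move=> c; apply: R0O; exists c; rewrite subrr; exact: kspan0.
have main a b : lexlt b a -> ~ vunit Ov (mon y a / mon y b).
  move=> ba [_ _]; have Sab : S (mon y a / mon y b) by exists a, b.
  exact: SO Sab (S0 _ Sab).
move=> a b U; apply: contrapT => /lexlt_total [] ab.
  by apply: (main _ _ ab); move/vunitV: U; rewrite invf_div.
exact: (main _ _ ab).
Qed.

End MonomialValuation.

Section FieldCore.
Variables (K L : fieldType) (iota : {rmorphism K -> L}) (V : nat -> L -> Prop) (gens : seq L).
Hypotheses (V1 : V 0 1) (V11 : V 1 1)
  (VM : forall n m a b, V n a -> V m b -> V (n + m)%N (a * b))
  (Vg : forall u, u \in gens -> V 1 u)
  (Vspan : forall n z, V n z -> kspan iota (fun x => exists t : seq L,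
     [/\ size t = n, all (mem gens) t & x = \prod_(u <- t) u]) z).

Lemma V_mono n m z : (n <= m)%N -> V n z -> V m z.
Proof.
move=> /subnK <-; elim: (m - n)%N => // k IH /IH Vz.
by rewrite addSn -addn1 -(mulr1 z); exact: VM.
Qed.

Lemma V_exp n z k : V n z -> V (k * n) (z ^+ k).
Proof. by move=> Vz; elim: k => // k IH; rewrite mulSn exprS; exact: VM. Qed.

Theorem products_dim : exists d C E q : nat, (0 < E)%N /\
  (forall n (I : finType) (f : I -> L), kfree iota f -> (forall i, V n (f i)) ->
      (#|I| <= C * n.+1 ^ d)%N) /\
  (forall n p m k, k = (E * m).+1 -> (k * p + k * d + q <= n)%N ->
    forall W, ksub iota W -> (forall x, W x -> V p x) ->
    forall (I : finType) (f : I -> L), kfree iota f -> (forall i, W (f i)) ->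
    exists (J : finType) (g : J -> L), [/\ kfree iota g, (k ^ d * #|I| <= #|J|)%N &
      forall j, exists v z, [/\ W v, V (n - k * p) z & g j = v ^+ k * z]]).
Proof.
have [d [y [ay yg rg]]] := exists_alg_indep iota gens.
have [C HC] := growth rg Vspan.
have [Ov [sO KO valO monO]] := monomial_valuation ay.
have Vmon m b : (forall i, (b i <= m)%N) -> V (m * d) (mon y b).
  move=> bm; have -> : (m * d)%N = (\sum_(i < d) m)%N by rewrite sum_nat_const card_ord mulnC.
  rewrite /mon; apply: (big_ind2 (fun x n => V n x)) => // [n1 x1 n2 x2|i _]; first exact: VM.
  apply: (@V_mono (b i * 1)); first by rewrite muln1.
  by apply/V_exp/Vg.
have rc1 : residue_free iota Ov 1 (fun _ : 'I_1 => 1).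
  move=> a [j aj]; rewrite big_ord1 mulr1 divr1; rewrite (ord1 j) in aj.
  exact: vunit_const.
pose e := (C * d.+1 ^ d)%N.
pose vecs m := {ffun 'I_d -> 'I_m.+1}.
pose mo m (b : vecs m) := mon y (fun i => b i).
have mo0 m b : @mo m b != 0 by exact: mon_neq0.
have moI m : vdistinct Ov (@mo m).
  move=> b b' _ _ /monO H; apply/ffunP => i; apply: val_inj.
  exact: (congr1 (fun h => h i) H).
have kappa_le q g r (c : 'I_r -> L) : g != 0 -> V q g -> (forall i, V q (c i)) ->
    residue_free iota Ov g c -> (r <= e)%N.
  move=> g0 Vqg Vqc rc.
  have := HC (q * d + q)%N _ _ (kfree_vdistinct sO valO g0 (mo0 q) (@moI q) rc).
  rewrite card_prod card_ffun !card_ord => H.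
  have {H} : (q.+1 ^ d * r <= C * (q * d + q).+1 ^ d)%N.
    apply: H => -[b j] /=; apply: VM => //; apply: Vmon => i; exact: leq_ord.
  move=> H; rewrite -(@leq_pmul2l (q.+1 ^ d)) ?expn_gt0 //; apply: leq_trans H _.
  rewrite /e mulnCA leq_mul2l -expnMn; apply/orP; right.
  by case: (posnP d) => [->//|d0]; rewrite leq_exp2r //; nia.
have torsion p w w' : w != 0 -> w' != 0 -> V p w -> V p w' ->
    exists j a b, [/\ (0 < j <= e)%N & vunit Ov ((w / w') ^+ j * mon y a / mon y b)].
  move=> w0 w'0 Vw Vw'.
  pose m := (e * p)%N.
  pose t (x : 'I_e.+1 * vecs m) := w ^+ x.1 * w' ^+ (e - x.1) * mo m x.2.
  have t0 x : t x != 0 by rewrite !mulf_neq0 ?expf_neq0.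
  have Vt x : V (m + m * d)%N (t x).
    apply: VM; last by apply: Vmon => i; exact: leq_ord.
    rewrite /m -{1}(subnKC (leq_ord x.1)) mulnDl; apply: VM; exact: V_exp.
  have nt : ~ vdistinct Ov t.
    move=> dt; have := HC _ _ _ (kfree_vdistinct sO valO (oner_neq0 _) t0 dt rc1).
    rewrite !card_prod card_ffun !card_ord muln1 => H.
    have {H} : (e.+1 * m.+1 ^ d <= C * (m + m * d).+1 ^ d)%N.
      by apply: H => -[x j]; rewrite /= mulr1.
    apply/negP; rewrite -ltnNge mulSn; apply: (@leq_ltn_trans (e * m.+1 ^ d)); last first.
      by rewrite -[X in (X < _)%N]add0n ltn_add2r expn_gt0.
    rewrite /e -mulnA leq_mul2l -expnMn; apply/orP; right.
    by case: (posnP d) => [->//|d0]; rewrite leq_exp2r //; nia.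
  move/existsNP: nt => [x] /existsNP [x'] /not_implyP [_] /not_implyP [_] /not_implyP [].
  wlog : x x' / (x'.1 <= x.1)%N.
    move=> H; case: (leqP x'.1 x.1) => [|/ltnW] le U nxx'; first exact: (H x x').
    by apply: (H x' x) => //; [move/vunitV: U; rewrite invf_div|move=> E; apply: nxx'].
  case: x x' => [i b] [i' b'] /= le U nxx'.
  have ii' : i != i'.
    apply/eqP => E; apply: nxx'; rewrite E in U *; congr pair; apply: moI => //.
    rewrite (_ : _ / _ = t (i', b) / t (i', b')) // /t /=.
    by field; rewrite !mo0 !expf_neq0.
  exists (i - i')%N, (fun h => nat_of_ord (b h)), (fun h => nat_of_ord (b' h)); split.
    have {}ii' : (i : nat) != i' by [].
    by rewrite subn_gt0 ltn_neqAle eq_sym le andbT ii' (leq_trans (leq_subr _ _)) ?leq_ord.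
  rewrite (_ : _ * _ / _ = t (i, b) / t (i', b')) // /t /=.
  have -> : (e - i' = (e - i) + (i - i'))%N by have := leq_ord i; lia.
  have : (i' + (i - i'))%N = i by rewrite subnKC.
  move: (i - i')%N (e - i)%N => k1 k2 <-; rewrite !exprD expr_div_n.
  by rewrite /mo; field; rewrite !expf_neq0 // (mon_neq0 ay).
have [q [g [kappa [c [g0 Vqg Vqc rc kmax]]]]] : exists q g kappa (c : 'I_kappa -> L),
    [/\ g != 0, V q g, forall i, V q (c i), residue_free iota Ov g c &
      forall q' g' r (c' : 'I_r -> L), g' != 0 -> V q' g' -> (forall i, V q' (c' i)) ->
    residue_free iota Ov g' c' -> (r <= kappa)%N].
  pose P r := `[< exists q g (c : 'I_r -> L), [/\ g != 0, V q g, forall i, V q (c i) &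
     residue_free iota Ov g c] >].
  have P0 : exists r, P r.
    by exists 0; apply/asboolP; exists 0, 1, (fun=> 0); split; [exact: oner_neq0|exact: V1|case|move=> a [[]]].
  have Pe r : P r -> (r <= e)%N.
    by move=> /asboolP [q [g [c [g0 Vqg Vqc rc]]]]; exact: (kappa_le _ _ _ _ g0 Vqg Vqc rc).
  case: (ex_maxnP P0 Pe) => r /asboolP [q [g [c [g0 Vqg Vqc rc]]]] rmax.
  exists q, g, r, c; split=> // q' g' r' c' g'0 Vg' Vc' rc'.
  by apply: rmax; apply/asboolP; exists q', g', c'.
pose E := (e`!)%N; exists d, C, E, q; split; first exact: fact_gt0.
split; first exact: HC.
move=> n p m k Ek kn W sW WV I f ff Wf.
have [|ws [ws0 wsW Wws dws]] := @values_seq _ _ iota Ov sO KO valO (C * p.+1 ^ d) W.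
  by move=> I' f' ff' Wf'; apply: HC ff' _ => i; exact: WV.
have sp : spanned iota W (kappa * size ws).
  apply: (spanned_values sO KO valO (leqnn _) sW ws0 wsW Wws) => g' r c' g'0 Wg' Wc' rc'.
  by apply: (kmax p g' r c' g'0 _ _ rc') => [|i]; exact: WV.
have Iws := steinitz sp ff Wf.
pose t (x : 'I_(size ws) * {ffun 'I_d -> 'I_k}) := ws`_(x.1) ^+ k * mon y (fun i => x.2 i).
have wsn0 (i : 'I_(size ws)) : ws`_i != 0 by apply: contraNneq ws0 => <-; exact: mem_nth.
have t0 x : t x != 0 by rewrite mulf_neq0 ?expf_neq0 ?(mon_neq0 ay).
have dt : vdistinct Ov t.
  case=> [i b] [i' b'] _ _; rewrite /t /= => U.
  have [u [Eu u0]] : exists u, u = ws`_i / ws`_i' /\ u != 0.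
    by exists (ws`_i / ws`_i'); rewrite mulf_neq0 ?invr_eq0.
  have Uk : vunit Ov (u ^+ k * mon y (fun i => b i) / mon y (fun i => b' i)).
    rewrite (_ : _ / _ = ws`_i ^+ k * mon y (fun i => b i) / (ws`_i' ^+ k * mon y (fun i => b' i))) //.
    by rewrite Eu expr_div_n; field; rewrite (mon_neq0 ay) expf_neq0.
  have [j [a [a' [/andP[j0 je] Uj]]]] := torsion p _ _ (wsn0 i) (wsn0 i')
     (WV _ (wsW _ (mem_nth _ (ltn_ord i)))) (WV _ (wsW _ (mem_nth _ (ltn_ord i')))).
  rewrite -Eu in Uj.
  (* k = j * m' + 1, so u itself has the value of a monomial quotient y^A / y^B. *)
  have /dvdnP [m' Em'] : (j %| E)%N by apply: dvdn_fact; rewrite j0.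
  pose s := (m' * m)%N.
  have Ek' : k = (s * j).+1 by rewrite Ek Em' /s; congr _.+1; ring.
  pose P := addexp (fun h => nat_of_ord (b h)) (fun i => s * a' i)%N.
  pose Q := addexp (fun h => nat_of_ord (b' h)) (fun i => s * a i)%N.
  have y0 := mon_neq0 ay.
  have Upq : vunit Ov (u * mon y P / mon y Q).
    have := vunit_div sO Uk (vunitX sO s Uj).
    have -> : u ^+ k = u * (u ^+ j) ^+ s by rewrite Ek' exprS mulnC exprM.
    rewrite /P /Q !monD !monX expr_div_n exprMn.
    set ujs := (u ^+ j) ^+ s; have ujs0 : ujs != 0 by rewrite !expf_neq0.
    by congr vunit; field; rewrite !expf_neq0 ?y0.
  have := vunit_div sO (vunitX sO k Upq) Uk.
  rewrite expr_div_n exprMn -!monX.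
  rewrite (_ : _ / _ = mon y (addexp (fun i => k * P i) (fun i => nat_of_ord (b' i)))%N /
     mon y (addexp (fun i => k * Q i) (fun i => nat_of_ord (b i)))%N); last first.
    by rewrite !monD; field; rewrite expf_neq0 // !y0.
  move=> /monO PQ.
  have PQi h : (k * P h + b' h = k * Q h + b h)%N := congr1 (fun f => f h) PQ.
  have bb' : b = b'.
    apply/ffunP => h; apply: val_inj => /=.
    have /(congr1 (modn^~ k)) := PQi h.
    by rewrite ![(k * _)%N]mulnC !modnMDl !modn_small.
  rewrite bb'; congr (_, _); apply: dws => //=; rewrite -Eu.
  suff <- : u * mon y P / mon y Q = u by [].
  have -> : P = Q.
    apply/funext => h; have := PQi h; rewrite bb' => /addIn /eqP.
    by rewrite eqn_pmul2l ?Ek // => /eqP.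
  by rewrite mulfK.
exists ('I_(size ws) * {ffun 'I_d -> 'I_k} * 'I_kappa)%type, (fun x => t x.1 * c x.2); split.
- exact: kfree_vdistinct g0 t0 dt rc.
- by rewrite !card_prod card_ffun !card_ord mulnAC mulnC leq_mul2r [(size ws * _)%N]mulnC Iws orbT.
- case=> -[i b] j; exists ws`_i, (mon y (fun i => b i) * c j); split.
  + exact/wsW/mem_nth.
  + apply: (@V_mono (k * d + q)); first by lia.
    by apply: VM => //; apply: Vmon => h; exact: ltnW.
  + by rewrite /t /= mulrA.
Qed.

End FieldCore.

(** * Graded algebras *)

Section FractionField.
Variables (K : fieldType) (A : comAlgType K).

Definition dom (intA : integral_alg A) : Type := A.

Section Inst.
Variable intA : integral_alg A.
HB.instance Definition _ := GRing.ComNzRing.copy (dom intA) A.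
Let D := dom intA.
Definition dom_unit : {pred D} := fun x => `[< exists y, y * x = 1 >].
Definition dom_inv (x : D) : D :=
  if pselect (exists y, y * x = 1) is left H then projT1 (cid H) else x.
Let mulVx : {in dom_unit, left_inverse 1 dom_inv *%R}.
Proof.
move=> x /asboolP xu; rewrite /dom_inv; case: pselect => // H.
by case: cid.
Qed.
Let unitPl (x y : D) : y * x = 1 -> dom_unit x.
Proof. by move=> yx; apply/asboolP; exists y. Qed.
Let invr_out : {in [predC dom_unit], dom_inv =1 id}.
Proof.
by move=> x /negP xu; rewrite /dom_inv; case: pselect => // H; case: xu; apply/asboolP.
Qed.
HB.instance Definition _ := GRing.ComNzRing_hasMulInverse.Build (dom intA) mulVx unitPl invr_out.
Let mulf_eq0' (x y : D) : x * y = 0 -> (x == 0) || (y == 0).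
Proof. by move=> /(intA.2 x y) [->|->]; rewrite eqxx ?orbT. Qed.
HB.instance Definition _ := GRing.ComUnitRing_isIntegral.Build (dom intA) mulf_eq0'.
End Inst.

Lemma fraction_field (intA : integral_alg A) :
  exists (L : fieldType) (phi : {rmorphism A -> L}), injective phi.
Proof.
pose f : {rmorphism dom intA -> {fraction (dom intA)}} := @tofrac (dom intA).
exists {fraction (dom intA)}, f => x y /eqP.
by rewrite tofrac_eq => /eqP.
Qed.
End FractionField.

Section Graded.
Variables (K : fieldType) (A : comAlgType K) (B : nat -> A -> Prop).
Hypothesis gB : graded_alg B.
Let io : {rmorphism K -> A} := in_alg A.

Lemma is_subspaceP (W : A -> Prop) : is_subspace W <-> ksub io W.
Proof.
split=> -[W0 sW]; split=> // c u v Wu Wv.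
  by rewrite /io /= mulr_algl; exact: sW.
by rewrite -mulr_algl; exact: sW.
Qed.

Lemma ksub_B n : ksub io (B n).
Proof. by apply/is_subspaceP; case: gB. Qed.
Lemma B_1 : B 0 1. Proof. by case: gB. Qed.
Lemma B_M n m a b : B n a -> B m b -> B (n + m) (a * b).
Proof. by case: gB => _ _ + _ _; exact. Qed.
Lemma B_0 n : B n 0. Proof. by case: (ksub_B n). Qed.

Definition decomp z (e : nat -> A) := (forall i, B i (e i)) /\
  exists2 N, (forall i, (N <= i)%N -> e i = 0) & z = \sum_(i < N) e i.

Lemma sum_widen (e : nat -> A) N M : (N <= M)%N -> (forall i, (N <= i)%N -> e i = 0) ->
  \sum_(i < N) e i = \sum_(i < M) e i.
Proof.
move=> NM e0; rewrite -!(big_mkord xpredT) (big_cat_nat (n := N) (p := M)) //=.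
by rewrite [X in _ + X]big_nat_cond [X in _ + X]big1 ?addr0 // => i /andP[/andP[/e0]].
Qed.

Lemma decomp_lin c u v e e' : decomp u e -> decomp v e' ->
  decomp (io c * u + v) (fun i => io c * e i + e' i).
Proof.
move=> [He [N eN ->]] [He' [N' eN' ->]]; split.
  by move=> i; exact: (ksub_B i).2.
exists (maxn N N'); first by move=> i; rewrite geq_max => /andP[/eN -> /eN' ->]; rewrite mulr0 addr0.
rewrite big_split -mulr_sumr; congr (_ * _ + _); apply: sum_widen => //; [exact: leq_maxl|exact: leq_maxr].
Qed.

Lemma decomp_hom n b : B n b -> decomp b (fun i => if i == n then b else 0).
Proof.
move=> Bb; split; first by move=> i; case: eqP => [->//|_]; exact: B_0.
exists n.+1; first by move=> i ni; case: eqP ni => // ->; rewrite ltnn.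
by rewrite big_ord_recr /= eqxx big1 ?add0r // => i _; rewrite ltn_eqF.
Qed.

Lemma decomp0 e : decomp 0 e -> forall i, e i = 0.
Proof.
move=> [He [N eN s0]] i; case: (ltnP i N) => [iN|/eN//].
have [_ _ _ _ /(_ N (fun i => e i)) H] := gB.
by exact: (H (fun i => He i) (esym s0) (Ordinal iN)).
Qed.

Lemma decomp_uniq z e e' : decomp z e -> decomp z e' -> forall i, e i = e' i.
Proof.
move=> He He'; have := decomp_lin (-1) He He'; rewrite rmorphN1 mulN1r addNr.
by move=> /decomp0 H i; have := H i; rewrite mulN1r addrC => /eqP; rewrite subr_eq0 => /eqP.
Qed.

Lemma exists_decomp z : exists e, decomp z e.
Proof.
have [_ _ _ /(_ z) [N [c [Bc ->]]] _] := gB.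
exists (fun i => if insub i is Some j then c j else 0); split.
  by move=> i; case: insubP => [j _ <-|_]; [exact: Bc|exact: B_0].
exists N; first by move=> i Ni; rewrite insubN // -leqNgt.
by apply: eq_bigr => i _; rewrite valK.
Qed.

Lemma kspan_decomp (G : nat -> A -> Prop) z : (forall i x, G i x -> B i x) ->
  kspan io (fun x => exists i, G i x) z -> exists2 e, decomp z e & forall i, kspan io (G i) (e i).
Proof.
move=> GB; elim=> [|c u v [i Gu] _ [e de Ge]].
  exists (fun=> 0); last by move=> i; exact: kspan0.
  by split; [move=> i; exact: B_0|exists 0; rewrite ?big_ord0].
exists (fun j => io c * (if j == i then u else 0) + e j).
  by apply: decomp_lin => //; apply/decomp_hom/GB.
move=> j; case: eqP => [->|_]; first exact: kspanD.
by rewrite mulr0 add0r.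
Qed.

Lemma kspan_hom (G : nat -> A -> Prop) n b : (forall i x, G i x -> B i x) ->
  kspan io (fun x => exists i, G i x) b -> B n b -> kspan io (G n) b.
Proof.
move=> GB /(kspan_decomp GB) [e de Ge] Bb.
by have := decomp_uniq de (decomp_hom Bb) n; rewrite eqxx => <-.
Qed.

Lemma prod_B (t : seq A) : (forall x, x \in t -> B 1 x) -> B (size t) (\prod_(x <- t) x).
Proof.
elim: t => [|x t IH] Ht; first by rewrite big_nil; exact: B_1.
rewrite big_cons -[size _]add1n; apply: B_M; first by apply/Ht/mem_head.
by apply: IH => z zt; apply: Ht; rewrite inE zt orbT.
Qed.

Definition prodsof (G : A -> Prop) n x :=
  exists t : seq A, [/\ size t = n, forall y, y \in t -> G y & x = \prod_(y <- t) y].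

Hypothesis genB : generated_by (B 1).

Lemma B_prods1 n b : B n b -> kspan io (prodsof (B 1) n) b.
Proof.
move=> Bb; apply: kspan_hom Bb => [i x [t [<- tB ->]]|]; first exact: prod_B.
have [k [c [t [tB ->]]]] := genB b.
apply: (ksub_sum (ksub_kspan _ _)) => i _; rewrite -mulr_algl.
apply: (ksubZ _ (ksub_kspan _ _)); apply: kspan_gen; exists (size (t i)), (t i).
by split=> // y; exact: tB.
Qed.

Lemma B0_const b : B 0 b -> exists c, b = io c.
Proof.
move=> /B_prods1; elim=> [|c u v [t [/size0nil -> _ ->]] _ [c' ->]].
  by exists 0; rewrite rmorph0.
by exists (c + c'); rewrite big_nil mulr1 rmorphD.
Qed.

Hypothesis ftA : finite_type_alg A.

Lemma finite_B1 : exists g : seq A, (forall x, x \in g -> B 1 x) /\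
  forall b, B 1 b -> kspan io (fun x => x \in g) b.
Proof.
have [s Hs] := ftA.
have /choice [e He] : forall z, exists e, decomp z e by exact: exists_decomp.
pose g := [seq e z 1%N | z <- s].
have gB1 x : x \in g -> B 1 x by move=> /mapP[z _ ->]; case: (He z).
exists g; split=> // b Bb.
pose G i x := match i with 0%N => x = 1 | 1%N => x \in g | _ => B i x end.
have GB i x : G i x -> B i x.
  by case: i => [|[|i]] //= => [->|]; [exact: B_1|exact: gB1].
suff H z : kspan io (fun x => exists i, G i x) z by have := kspan_hom GB (H b) Bb.
have sQ := ksub_kspan io (fun x => exists i, G i x).
have QM x y : kspan io (fun x => exists i, G i x) x -> kspan io (fun x => exists i, G i x) y ->
    kspan io (fun x => exists i, G i x) (x * y).
  apply: kspan_mul => // u v [[|i] Gu] [[|j] Gv].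
  - by rewrite Gu mul1r; apply: kspan_gen; exists 0%N.
  - by rewrite Gu mul1r; apply: kspan_gen; exists j.+1.
  - by rewrite Gv mulr1; apply: kspan_gen; exists i.+1.
  - apply: kspan_gen; exists (i.+1 + j.+1)%N; rewrite addSn addnS /=.
    by rewrite -addnS -addSn; apply: B_M; exact: GB.
have Q1 : kspan io (fun x => exists i, G i x) 1 by apply: kspan_gen; exists 0%N.
have Qs x : x \in s -> kspan io (fun x => exists i, G i x) x.
  move=> xs; have [Be [N _ ->]] := He x; apply: (ksub_sum sQ) => -[i /= _] _.
  case: i (Be i) => [/B0_const [c ->]|[|i] Bi].
  - by rewrite -(mulr1 (io c)); exact: (ksubZ _ sQ).
  - by apply: kspan_gen; exists 1%N; exact: map_f.
  - by apply: kspan_gen; exists i.+2.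
have [k [c [t [ts ->]]]] := Hs z.
apply: (ksub_sum sQ) => i _; rewrite -mulr_algl; apply: (ksubZ _ sQ).
elim: (t i) (ts i) => [|x l IH] Hl; first by rewrite big_nil.
rewrite big_cons; apply: QM; first by apply/Qs/Hl/mem_head.
by apply: IH => y yl; apply: Hl; rewrite inE yl orbT.
Qed.

Lemma finite_B : exists g : seq A, (forall x, x \in g -> B 1 x) /\
  forall n b, B n b -> kspan io (prodsof (fun x => x \in g) n) b.
Proof.
have [g [gB1 Hg]] := finite_B1; exists g; split=> // n b /B_prods1.
apply: kspan_least; first exact: ksub_kspan.
move=> _ [t [<- tB ->]]; elim: t tB => [_|x t IH tB].
  by rewrite big_nil; apply: kspan_gen; exists [::]; rewrite big_nil.
rewrite big_cons; apply: (@kspan_mul _ _ _ (fun x => x \in g) (prodsof (fun x => x \in g) (size t))).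
- exact: ksub_kspan.
- move=> u v ug [t' [st tg ->]]; apply: kspan_gen; exists (u :: t'); rewrite big_cons; split=> //.
    by rewrite /= st.
  by move=> y; rewrite inE => /predU1P[->|/tg].
- by apply/Hg/tB/mem_head.
- by apply: IH => y yt; apply: tB; rewrite inE yt orbT.
Qed.

Lemma B_split n m a (W : A -> Prop) : is_subspace W ->
  (forall b c, B n b -> B m c -> W (b * c)) -> B (n + m) a -> W a.
Proof.
move=> /is_subspaceP sW HW /B_prods1; apply: kspan_least => // _ [t [st tB ->]].
rewrite -(cat_take_drop n t) big_cat /=; apply: HW.
  rewrite -[X in B X](_ : size (take n t) = n); last by rewrite size_takel // st leq_addr.
  by apply: prod_B => x /mem_take; exact: tB.
rewrite -[X in B X](_ : size (drop n t) = m); last by rewrite size_drop st addKn.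
by apply: prod_B => x /mem_drop; exact: tB.
Qed.

Lemma krull_B1 : krull_dim_pos A -> exists2 x, B 1 x & x != 0.
Proof.
move=> [P [Q [pP [pQ [PQ [x [Qx nPx]]]]]]]; apply: contrapT => nB.
have B1 b : B 1 b -> b = 0.
  by move=> Bb; apply/eqP; apply: contrapT => /negP b0; apply: nB; exists b.
have [e [He [N eN xE]]] := exists_decomp x.
have e0 i : e i.+1 = 0.
  have := B_prods1 (He i.+1); elim=> // c u v [[|y t] [//= _ tB ->]] _ ->.
  by rewrite big_cons (B1 y) ?mul0r ?mulr0 ?addr0 //; apply/tB/mem_head.
have [c Ec] := B0_const (He 0%N).
have {}xE : x = io c.
  rewrite xE -Ec; case: N eN {xE} => [|N] eN; first by rewrite big_ord0 eN.
  by rewrite big_ord_recl big1 ?addr0 // => i _; exact: e0.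
have c0 : c != 0.
  by apply/eqP => c0; apply: nPx; rewrite xE c0 rmorph0; case: pP.
case: pQ => _ _ QM nQ1 _; apply: nQ1.
by rewrite -(rmorph1 io) -(mulVf c0) rmorphM -xE; exact: QM.
Qed.

Lemma lin_freeP (s : seq A) : lin_free s <-> kfree io (fun i : 'I_(size s) => s`_i).
Proof.
split=> H c Hc; apply: H; rewrite -[RHS]Hc; apply: eq_bigr => i _.
  by rewrite /io /= mulr_algl.
by rewrite /io /= mulr_algl.
Qed.

Lemma kfree_lin_free (I : finType) (f : I -> A) : kfree io f ->
  lin_free [seq f i | i <- enum I].
Proof.
move=> ff; apply/lin_freeP => c.
have sz : size [seq f i | i <- enum I] = #|I| by rewrite size_map -cardE.
have szi (i : I) : (enum_rank i < size [seq f i | i <- enum I])%N by rewrite sz; exact: ltn_ord.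
have H0 := ff (fun i => c (Ordinal (szi i))).
move=> Hc j.
have Hj : (j < #|I|)%N by rewrite -sz.
have -> : j = Ordinal (szi (enum_val (Ordinal Hj))) by apply: val_inj; rewrite /= enum_valK.
apply: H0; rewrite -[RHS]Hc [RHS](reindex (fun i => Ordinal (szi i))) /=.
  apply: eq_bigr => i _; congr (_ * _).
  by rewrite (nth_map i) -?cardE // nth_enum_rank.
apply: onW_bij; exists (fun j : 'I_(size _) => enum_val (cast_ord sz j)) => k.
  by rewrite (_ : cast_ord _ _ = enum_rank k) ?enum_rankK //; exact: val_inj.
by apply: val_inj; rewrite /= enum_valK.
Qed.

Hypotheses (intA : integral_alg A) (kA : krull_dim_pos A).

Theorem graded_products_dim : exists d C E q : nat, (0 < E)%N /\
  (forall n (s : seq A), lin_free s -> (forall x, x \in s -> B n x) ->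
      (size s <= C * n.+1 ^ d)%N) /\
  (forall n p m k, k = (E * m).+1 -> (k * p + k * d + q <= n)%N ->
    forall W, is_subspace W -> (forall x, W x -> B p x) ->
    forall s, lin_free s -> (forall x, x \in s -> W x) ->
    exists s', [/\ lin_free s', (k ^ d * size s <= size s')%N &
      forall x, x \in s' -> exists v z, [/\ W v, B (n - k * p) z & x = v ^+ k * z]]).
Proof.
have [L [phi phiI]] := fraction_field intA.
have [x0 Bx0 x0n] := krull_B1 kA.
have phi_eq0 x : (phi x == 0) = (x == 0) by rewrite -(rmorph0 phi) (inj_eq phiI).
have px0 : phi x0 != 0 by rewrite phi_eq0.
pose iota : {rmorphism K -> L} := phi \o io.
have iotaE c : iota c = phi (io c) by [].
pose tr n a := phi a / phi x0 ^+ n.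
have trI n a a' : tr n a = tr n a' -> a = a'.
  by move=> /(mulIf _) E; apply/phiI/E; rewrite invr_eq0 expf_neq0.
have trD n c u v : tr n (io c * u + v) = iota c * tr n u + tr n v.
  by rewrite /tr iotaE rmorphD rmorphM mulrDl mulrA.
have trM n m a b : tr (n + m)%N (a * b) = tr n a * tr m b.
  by rewrite /tr rmorphM exprD; field; rewrite !expf_neq0.
have tr0 n : tr n 0 = 0 by rewrite /tr rmorph0 mul0r.
have trX n a k : tr (k * n)%N (a ^+ k) = tr n a ^+ k.
  by rewrite /tr rmorphXn expr_div_n mulnC exprM.
have tr_sum n (I : finType) (c : I -> K) (f : I -> A) :
    tr n (\sum_i io (c i) * f i) = \sum_i iota (c i) * tr n (f i).
  by rewrite /tr rmorph_sum mulr_suml; apply: eq_bigr => i _; rewrite rmorphM mulrA.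
have trfree n (I : finType) (f : I -> A) : kfree io f -> kfree iota (fun i => tr n (f i)).
  by move=> ff c; rewrite -tr_sum -(tr0 n) => /trI /ff.
have trfree' n (I : finType) (f : I -> A) : kfree iota (fun i => tr n (f i)) -> kfree io f.
  by move=> ff c Hc; apply: ff; rewrite -tr_sum Hc tr0.
pose im n (W : A -> Prop) z := exists2 a, W a & z = tr n a.
have [g [gB1 Hg]] := finite_B.
pose gens := [seq tr 1 x | x <- g].
have imsub n W : ksub io W -> ksub iota (im n W).
  move=> [W0 sW]; split; first by exists 0; rewrite ?tr0.
  by move=> c _ _ [u Wu ->] [v Wv ->]; exists (io c * u + v); rewrite ?trD //; exact: sW.
have [|||||d [C [E [q [E0 [HC HE]]]]]] := @products_dim K L iota (fun n => im n (B n)) gens.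
- by exists 1; [exact: B_1|rewrite /tr rmorph1 expr0 divr1].
- by exists x0; rewrite // /tr expr1 divff.
- by move=> n m _ _ [a Ba ->] [b Bb ->]; exists (a * b); rewrite ?trM //; exact: B_M.
- by move=> _ /mapP[x xg ->]; exists x => //; exact: gB1.
- move=> n _ [a Ba ->]; elim: (Hg _ _ Ba) => [|c u v [t [st tg ->]] _ IH].
    by rewrite tr0; exact: kspan0.
  rewrite trD; apply: kspanD => //; exists [seq tr 1 x | x <- t]; split.
  + by rewrite size_map.
  + by apply/allP => _ /mapP[x /tg xg ->]; exact: map_f.
  + rewrite -st; elim: (t) => [|x l IHl]; first by rewrite !big_nil /tr rmorph1 expr0 divr1.
    by rewrite big_cons /= big_cons -IHl -trM.
exists d, C, E, q; split=> //; split.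
  move=> n s /lin_freeP /(trfree n) sf sB.
  have := HC n _ _ sf; rewrite card_ord; apply => i.
  by exists s`_i => //; apply/sB/mem_nth.
move=> n p m k Ek kn W /is_subspaceP sW WB s /lin_freeP /(trfree p) sf sWs.
have [|i|J [h [hf hJ Hh]]] := HE n p m k Ek kn (im p W) (imsub p _ sW) _ _ _ sf.
- by move=> _ [a Wa ->]; exists a => //; exact: WB.
- by exists s`_i => //; apply/sWs/mem_nth.
have /choice [f Hf] : forall j, exists f, h j = tr n f /\
    exists v z, [/\ W v, B (n - k * p) z & f = v ^+ k * z].
  move=> j; have [_ [_ [[v Wv ->] [z Bz ->] ->]]] := Hh j.
  exists (v ^+ k * z); split; last by exists v, z.
  by rewrite -trX -trM subnKC // (leq_trans _ kn) // -addnA leq_addr.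
exists [seq f j | j <- enum J]; split.
- apply/kfree_lin_free/(trfree' n).
  by move=> c Hc; apply: hf; rewrite -[RHS]Hc; apply: eq_bigr => j _; rewrite (Hf j).1.
- by move: hJ; rewrite size_map -cardE card_ord.
- by move=> _ /mapP[j _ ->]; case: (Hf j).
Qed.

End Graded.

(** * Pseudo-filtrations *)

Section Dyadic.
Variables (R : realType) (f : nat -> R).
Hypotheses (f0 : forall n, 0 <= f n) (fmono : forall n m, (n <= m)%N -> f n <= f m)
  (fcvg : cvgn (series (fun a : nat => f (2 ^ a)%N / (2 ^ a)%:R))).

Lemma dyadic_tail (e : R) : 0 < e -> exists P, (0 < P)%N /\ forall p j, (P <= p)%N ->
  \sum_(i < j) f (2 ^ i * p)%N / (2 ^ i * p)%:R <= e.
Proof.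
move=> e0; pose u a := f (2 ^ a)%N / (2 ^ a)%:R.
have u0 a : 0 <= u a by rewrite divr_ge0.
have nd : nondecreasing_seq (series u) by apply: nondecreasing_series => n _ _; exact: u0.
have e20 : 0 < e / 2 by lra.
have [A _ HA] : \forall n \near \oo, `|limn (series u) - series u n| < e / 2.
  by have /cvgrPdist_lt /(_ _ e20) := fcvg.
have tail N : (A <= N)%N -> series u N - series u A <= e / 2.
  move=> AN; have := HA A (leqnn A); have := nondecreasing_cvgn_le nd fcvg N.
  have := nondecreasing_cvgn_le nd fcvg A; move=> h1 h2.
  by rewrite ger0_norm ?subr_ge0 // => h3; lra.
exists (2 ^ A)%N; split; first by rewrite expn_gt0.
move=> p j Pp.
have p0 : (0 < p)%N by apply: leq_trans Pp; rewrite expn_gt0.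
have [a [Aa ap pa]] : exists a, [/\ (A <= a)%N, (2 ^ a <= p)%N & (p < 2 ^ a.+1)%N].
  exists (trunc_log 2 p); split; [exact: trunc_log_max|exact: trunc_logP|exact: trunc_log_ltn].
have : \sum_(i < j) f (2 ^ i * p)%N / (2 ^ i * p)%:R <= \sum_(i < j) 2 * u (a.+1 + i)%N.
  apply: ler_sum => i _; rewrite /u.
  have h1 : f (2 ^ i * p)%N <= f (2 ^ (a.+1 + i))%N.
    by apply: fmono; rewrite addnC expnD leq_mul2l ltnW ?orbT.
  have h2 : ((2 ^ i * p)%:R)^-1 <= 2 * ((2 ^ (a.+1 + i))%:R)^-1 :> R.
    rewrite addSn expnS [X in _ <= _ * X^-1]natrM invfM mulrA divff ?pnatr_eq0 // mul1r.
    rewrite lef_pV2 ?posrE ?ltr0n ?muln_gt0 ?expn_gt0 ?p0 //.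
    by rewrite ler_nat addnC expnD leq_mul2l ap orbT.
  by rewrite mulrCA ler_pM // invr_ge0.
move=> /le_trans; apply.
rewrite -mulr_sumr -(big_mkord xpredT (fun i => u (a.+1 + i)%N)).
have := @tail (a.+1 + j)%N; rewrite (leq_trans Aa) ?(leq_trans (leqnSn a)) ?leq_addr // => /(_ isT).
rewrite /series /=.
have -> : \sum_(0 <= k < a.+1 + j) u k = \sum_(0 <= k < A) u k + \sum_(A <= k < a.+1) u k
    + \sum_(0 <= i < j) u (a.+1 + i)%N.
  rewrite -big_cat_nat //=; last by rewrite (leq_trans Aa).
  rewrite (@big_cat_nat _ _ _ a.+1 0 (a.+1 + j)) ?leq_addr //=; congr (_ + _).
  by rewrite -{1}(add0n a.+1) big_addn addKn; apply: eq_bigr => i _; rewrite addnC.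
have : 0 <= \sum_(A <= k < a.+1) u k by apply: sumr_ge0.
by lra.
Qed.

Lemma dyadic_small (e : R) : 0 < e -> exists P, (0 < P)%N /\ forall p, (P <= p)%N -> f p <= e * p%:R.
Proof.
move=> /dyadic_tail [P [P0 HP]]; exists P; split=> // p Pp.
have := HP p 1%N Pp; rewrite big_ord1 expn0 mul1n ler_pdivrMr // ltr0n.
exact: leq_trans Pp.
Qed.

(* A product of m factors, bracketed by halving, loses f only at the dyadic scales. *)
Lemma halving (Q : nat -> R -> Prop) (M p : nat) (c e : R) : (0 < M)%N -> (0 < p)%N -> 0 <= c ->
  (forall j, \sum_(i < j) f (2 ^ i * (M * p))%N / (2 ^ i * (M * p))%:R <= e) ->
  (forall m l l', l <= l' -> Q m l -> Q m l') ->
  (forall m, (M <= m <= 2 * M)%N -> Q m c) ->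
  (forall m1 m2 l1 l2, (M <= m1)%N -> (M <= m2)%N -> Q m1 l1 -> Q m2 l2 ->
     Q (m1 + m2)%N (l1 + l2 + f (m1 * p)%N + f (m2 * p)%N)) ->
  forall m, (M <= m)%N -> Q m (m%:R * (c + 2 * p%:R * e)).
Proof.
move=> M0 p0 c0 He Qm Qb QD.
pose S j := \sum_(i < j) f (2 ^ i * (M * p))%N / (2 ^ i)%:R : R.
have S0 j : 0 <= S j by apply: sumr_ge0 => i _; rewrite divr_ge0.
have main j m : (2 ^ j * M <= m <= 2 ^ j.+1 * M)%N -> Q m ((2 ^ j)%:R * (c + 2 * S j.+1)).
  elim: j m => [|j IH] m.
    rewrite expn0 mul1n expn1 => /Qb; apply: Qm; rewrite mul1r.
    by have := S0 1%N; lra.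
  move=> /andP[m1 m2].
  have Em : (m = m./2 + uphalf m)%N by lia.
  have hb1 : (2 ^ j * M <= m./2 <= 2 ^ j.+1 * M)%N by rewrite !expnS in m1 m2 *; lia.
  have hb2 : (2 ^ j * M <= uphalf m <= 2 ^ j.+1 * M)%N by rewrite !expnS in m1 m2 *; lia.
  have jM : (M <= 2 ^ j * M)%N by rewrite leq_pmull ?expn_gt0.
  have M1 : (M <= m./2)%N by apply: leq_trans jM _; case/andP: hb1.
  have M2 : (M <= uphalf m)%N by apply: leq_trans jM _; case/andP: hb2.
  have := QD _ _ _ _ M1 M2 (IH _ hb1) (IH _ hb2); rewrite -Em; apply: Qm.
  have fh1 : f (m./2 * p)%N <= f (2 ^ j.+1 * (M * p))%N.
    by apply: fmono; rewrite mulnA leq_mul2r; case/andP: hb1 => _ ->; rewrite orbT.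
  have fh2 : f (uphalf m * p)%N <= f (2 ^ j.+1 * (M * p))%N.
    by apply: fmono; rewrite mulnA leq_mul2r; case/andP: hb2 => _ ->; rewrite orbT.
  have -> : S j.+2 = S j.+1 + f (2 ^ j.+1 * (M * p))%N / (2 ^ j.+1)%:R.
    by rewrite /S big_ord_recr.
  have E : (2 ^ j.+1)%:R * (f (2 ^ j.+1 * (M * p))%N / (2 ^ j.+1)%:R) = f (2 ^ j.+1 * (M * p))%N.
    by rewrite mulrC divfK // pnatr_eq0 expn_eq0.
  move: E; set x := f (2 ^ j.+1 * (M * p))%N; set a := (2 ^ j.+1)%:R => E.
  have -> : a * (c + 2 * (S j.+1 + x / a)) = a * (c + 2 * S j.+1) + 2 * (a * (x / a)) by ring.
  rewrite E /a /x; move: fh1 fh2; move: (f (2 ^ j.+1 * _)%N) => F fh1 fh2.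
  by rewrite expnS natrM; lra.
move=> m Mm.
have mM0 : (0 < m %/ M)%N by rewrite divn_gt0.
pose j := trunc_log 2 (m %/ M).
have j1 : (2 ^ j * M <= m)%N by rewrite -leq_divRL // trunc_logP.
have j2 : (m <= 2 ^ j.+1 * M)%N by apply: ltnW; rewrite -ltn_divLR // trunc_log_ltn.
have := main j m; rewrite j1 j2 => /(_ isT); apply: Qm.
have Sp : S j.+1 <= (M * p)%:R * e.
  have Mp0 : (0 : R) < (M * p)%:R by rewrite ltr0n muln_gt0 M0.
  rewrite mulrC -ler_pdivrMr //; apply: le_trans (He j.+1); rewrite mulr_suml.
  by apply: ler_sum => i _; rewrite [X in _ <= _ / X]natrM invfM mulrA.
have h : (2 ^ j)%:R * M%:R <= m%:R :> R by rewrite -natrM ler_nat.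
have e0 : 0 <= e by have := He 0%N; rewrite big_ord0.
have M1 : 1 <= M%:R :> R by rewrite ler1n.
have jj : (0 : R) <= (2 ^ j)%:R by [].
have p0' : 0 <= p%:R * e by rewrite mulr_ge0.
rewrite natrM in Sp; move: Sp h M1 jj p0'.
move: (2 ^ j)%:R (S j.+1) M%:R (m%:R : R) => a s b x Sp h M1 jj p0'.
apply: (@le_trans _ _ (a * (c + 2 * (b * p%:R * e)))).
  by apply: ler_wpM2l => //; lra.
have -> : a * (c + 2 * (b * p%:R * e)) = a * c + (a * b) * (2 * (p%:R * e)) by ring.
have -> : x * (c + 2 * p%:R * e) = x * c + x * (2 * (p%:R * e)) by ring.
apply: lerD; apply: ler_wpM2r => //; last by lra.
by apply: le_trans h; rewrite ler_peMr.
Qed.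

End Dyadic.

Section Dimension.
Variables (K : fieldType) (A : lmodType K).
Implicit Types W : A -> Prop.

Lemma subspaceZ W c u : is_subspace W -> W u -> W (c *: u).
Proof. by move=> [W0 sW] Wu; rewrite -(addr0 (_ *: _)); exact: sW. Qed.

Lemma subspace_sum W n (c : 'I_n -> K) (v : 'I_n -> A) : is_subspace W ->
  (forall i, W (v i)) -> W (\sum_i c i *: v i).
Proof.
move=> [W0 sW] Wv; elim/big_ind: _ => // [x y Wx Wy|i _]; first by rewrite -(scale1r x); exact: sW.
exact: subspaceZ.
Qed.

Lemma lin_free_cons W (s : seq A) x : is_subspace W -> (forall y, y \in s -> W y) ->
  lin_free s -> ~ W x -> lin_free (x :: s).
Proof.
move=> sW Ws fs nWx c; rewrite /= big_ord_recl /= => E.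
have c0 : c ord0 = 0.
  apply/eqP; apply: contrapT => /negP c0; apply: nWx.
  rewrite -(scale1r x) -(mulVf c0) -scalerA; apply: subspaceZ => //.
  move/eqP: E; rewrite addr_eq0 => /eqP ->; rewrite -scaleN1r; apply: subspaceZ => //.
  by apply: subspace_sum => // i; rewrite add0n; apply/Ws/mem_nth.
move=> i; case: (unliftP ord0 i) => [j ->|-> //].
by move: E; rewrite c0 scale0r add0r => /(fs (fun j => c (lift ord0 j))).
Qed.

Lemma has_dim_exists W m : (forall s : seq A, (forall x, x \in s -> W x) -> lin_free s -> (size s <= m)%N) ->
  exists d, has_dim W d.
Proof.
move=> Hm; pose P r := `[< exists s : seq A, size s = r /\ (forall x, x \in s -> W x) /\ lin_free s >].
have P0 : exists r, P r by exists 0; apply/asboolP; exists [::]; split=> //; split=> // c _ [].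
have Pm r : P r -> (r <= m)%N by move=> /asboolP [s [<- [sW fs]]]; exact: Hm.
case: (ex_maxnP P0 Pm) => d /asboolP Hd dmax; exists d; split=> // s sW fs.
by apply: dmax; apply/asboolP; exists s.
Qed.

Section Filtration.
Variables (R : realType) (W : A -> Prop) (F : R -> A -> Prop) (m : nat).
Hypotheses (gF : good_filtration W F)
  (Hm : forall s : seq A, (forall x, x \in s -> W x) -> lin_free s -> (size s <= m)%N).

Lemma filtration_full : exists s, forall b, W b -> F s b.
Proof.
case: gF => sF antiF _ exF _.
pose P r := `[< exists s (l : seq A), [/\ size l = r, lin_free l & forall x, x \in l -> F s x] >].
have P0 : exists r, P r by exists 0; apply/asboolP; exists 0, [::]; split=> // c _ [].
have Pm r : P r -> (r <= m)%N.
  by move=> /asboolP [s [l [<- fl lF]]]; apply: Hm => // x /lF; exact: (sF s).2.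
case: (ex_maxnP P0 Pm) => r /asboolP [s [l [sl fl lF]]] rmax; exists s => b Wb.
apply: contrapT => nFb; have [s' Fb] := exF _ Wb.
suff /rmax : P r.+1 by rewrite ltnn.
apply/asboolP; exists (Num.min s s'), (b :: l); split; first by rewrite /= sl.
  exact: (lin_free_cons (sF s).1 lF).
move=> x; rewrite inE => /predU1P[->|/lF].
  by apply: antiF Fb; rewrite ge_min lexx orbT.
by apply: antiF; rewrite ge_min lexx.
Qed.

Lemma filtration_trivial : exists s, forall b, F s b -> b = 0.
Proof.
case: gF => sF antiF sepF _ _.
pose P r := `[< exists s, forall l : seq A, lin_free l -> (forall x, x \in l -> F s x) -> (size l <= r)%N >].
have P0 : exists r, P r.
  exists m; apply/asboolP; exists 0 => l fl lF; apply: Hm => // x /lF; exact: (sF 0).2.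
case: (ex_minnP P0) => r /asboolP [s Hs] rmin; exists s => b Fb; apply: contrapT => b0.
have [t nFt] : exists t, ~ F t b by apply: contrapT => H; apply/b0/sepF => t; apply: contrapT => nF; apply: H; exists t.
have st : s < t by rewrite ltNge; apply/negP => ts; apply: nFt; exact: antiF Fb.
have Ht l : lin_free l -> (forall x, x \in l -> F t x) -> (size l < r)%N.
  move=> fl lF; apply: (Hs (b :: l)); first exact: (lin_free_cons (sF t).1 lF).
  by move=> x; rewrite inE => /predU1P[->//|/lF]; apply: antiF; exact: ltW.
have r0 : (0 < r)%N by apply: leq_ltn_trans (Ht [::] _ _) => // c _ [].
have : (r <= r.-1)%N.
  by apply: rmin; apply/asboolP; exists t => l fl lF; rewrite -ltnS prednK //; exact: Ht.
by rewrite leqNgt prednK // leqnn.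
Qed.

End Filtration.
End Dimension.

Section PseudoFiltered.
Variables (R : realType) (K : fieldType) (A : comAlgType K) (f : nat -> R)
  (B : nat -> A -> Prop) (F : nat -> R -> A -> Prop).
Hypotheses (f0 : forall n, 0 <= f n) (fmono : forall n m, (n <= m)%N -> f n <= f m)
  (fcvg : cvgn (series (fun a : nat => f (2 ^ a)%N / (2 ^ a)%:R)))
  (gB : graded_alg B) (intA : integral_alg A) (ftA : finite_type_alg A)
  (genB : generated_by (B 1%N)) (kA : krull_dim_pos A)
  (gF : forall n, (1 <= n)%N -> good_filtration (B n) (F n))
  (pseudo : exists N : nat, forall (n m : nat), (N <= n)%N -> (N <= m)%N ->
     forall (s t : R) (a b : A), F n s a -> F m t b ->
       F (n + m)%N (s + t - f n - f m) (a * b)).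

Lemma F_sub n s : (1 <= n)%N -> is_subspace (F n s).
Proof. by move=> /gF [sF _ _ _ _]; case: (sF s). Qed.
Lemma F_B n s a : (1 <= n)%N -> F n s a -> B n a.
Proof. by move=> /gF [sF _ _ _ _]; case: (sF s) => _; exact. Qed.
Lemma F_anti n s t a : (1 <= n)%N -> s <= t -> F n t a -> F n s a.
Proof. by move=> /gF [_ + _ _ _]; exact. Qed.

Lemma dim_bound n : exists m, forall s : seq A, (forall x, x \in s -> B n x) -> lin_free s -> (size s <= m)%N.
Proof.
have [d [C [E [q [_ [HC _]]]]]] := graded_products_dim gB genB ftA intA kA.
by exists (C * n.+1 ^ d)%N => s sB fs; exact: HC.
Qed.

Lemma lower_bound : exists2 C1 : R, 0 <= C1 & forall n b, (1 <= n)%N -> B n b -> F n (- (C1 * n%:R)) b.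
Proof.
have [N HN] := pseudo.
have [P [P0 HP]] := dyadic_tail f0 fmono fcvg ltr01.
pose M := maxn 1 (maxn N P).
have [M1 MN MP] : [/\ (1 <= M)%N, (N <= M)%N & (P <= M)%N] by rewrite /M; split; lia.
have /choice [s Hs] : forall n, exists s : R, 0 <= s /\ ((1 <= n)%N -> forall b, B n b -> F n (- s) b).
  move=> n; case: (posnP n) => [->|n1]; first by exists 0.
  have [m Hm] := dim_bound n; have [s Hs] := filtration_full (gF n1) Hm.
  exists `|s|; split=> // _ b Bb; apply: F_anti (Hs b Bb) => //.
  by rewrite lerNl -normrN; exact: ler_norm.
pose c := \sum_(i < (2 * M).+1) s i.
have c0 : 0 <= c by apply: sumr_ge0 => i _; case: (Hs i).
have sc i : (i <= 2 * M)%N -> s i <= c.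
  rewrite -ltnS => Hi; rewrite /c (bigD1 (Ordinal Hi)) //= lerDl.
  by apply: sumr_ge0 => j _; case: (Hs j).
exists (c + 2); first by lra.
have big n : (M <= n)%N -> (0 < n)%N -> forall b, B n b -> F n (- (n%:R * (c + 2 * 1%:R * 1))) b.
  apply: (@halving R f f0 fmono (fun n l => (0 < n)%N -> forall b, B n b -> F n (- l) b) M 1 c 1) => //.
  - by move=> j; rewrite muln1; exact: HP.
  - by move=> m l l' ll' Hl m0 b Bb; apply: F_anti (Hl m0 b Bb) => //; rewrite lerN2.
  - move=> m /andP[m1 m2] m0 b Bb.
    by apply: F_anti ((Hs m).2 m0 b Bb) => //; rewrite lerN2; exact: sc.
  - move=> m1 m2 l1 l2 h1 h2 H1 H2 m0 b.
    apply: (B_split gB genB); first exact: F_sub.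
    move=> x y /(H1 (leq_trans M1 h1)) Fx /(H2 (leq_trans M1 h2)) Fy.
    have := HN m1 m2 (leq_trans MN h1) (leq_trans MN h2) _ _ _ _ Fx Fy.
    by rewrite !muln1; congr F; ring.
move=> n b n1 Bb; have [nM|nM] := leqP M n.
  by have := big n nM n1 b Bb; congr F; ring.
apply: F_anti ((Hs n).2 n1 b Bb) => //; rewrite lerN2.
have := sc n; rewrite (_ : (n <= 2 * M)%N) => [/(_ isT) h|]; last by lia.
have : 1 <= n%:R :> R by rewrite ler1n.
by move=> h1; apply: (le_trans h); nra.
Qed.

Lemma power_bound (e : R) : 0 < e -> exists P, (0 < P)%N /\ forall p k s v, (P <= p)%N -> (0 < k)%N ->
  F p s v -> F (k * p)%N (k%:R * s - 4 * e * (k * p)%:R) (v ^+ k).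
Proof.
move=> e0; have [N HN] := pseudo.
have [P [P0 HP]] := dyadic_tail f0 fmono fcvg e0.
have [P' [P'0 HP']] := dyadic_small f0 fmono fcvg e0.
exists (maxn P (maxn P' N)); split; first by rewrite leq_max P0.
move=> p k s v; rewrite !geq_max => /and3P[Pp P'p Np] k0 Fv.
have p0 : (0 < p)%N by exact: leq_trans Pp.
have kp_gt0 m : (1 <= m)%N -> (1 <= m * p)%N by rewrite muln_gt0 p0 andbT.
have fp := HP' p P'p.
have Npm m : (1 <= m)%N -> (N <= m * p)%N by move=> m1; apply: leq_trans Np _; rewrite leq_pmull.
pose Q m (l : R) := (0 < m)%N -> F (m * p)%N (m%:R * s - l) (v ^+ m).
have : Q k (k%:R * (2 * f p + 2 * p%:R * e)).
  apply: (@halving R f f0 fmono Q 1 p (2 * f p) e) => //.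
  - by have := f0 p; lra.
  - by move=> j; rewrite mul1n; exact: HP.
  - move=> m l l' ll' Ql m0; apply: F_anti (Ql m0); first exact: kp_gt0.
    by rewrite lerB.
  - have f0p := f0 p; case=> [|[|[|m]]] //= _ _; rewrite /Q.
      by rewrite mul1n expr1; apply: F_anti Fv => //; lra.
    have := HN p p Np Np s s v v Fv Fv.
    by rewrite -expr2 addnn -mul2n; congr F; ring.
  - move=> m1 m2 l1 l2 h1 h2 Q1 Q2 _.
    have := HN _ _ (Npm _ h1) (Npm _ h2) _ _ _ _ (Q1 h1) (Q2 h2).
    by rewrite -mulnDl -exprD; congr F; rewrite natrD; ring.
move=> /(_ k0); apply: F_anti; first exact: kp_gt0.
rewrite lerB // natrM.
have k0' : 0 <= k%:R :> R by [].
have : k%:R * (2 * f p) <= k%:R * (2 * (e * p%:R)) by apply: ler_wpM2l => //; lra.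
by move: (k%:R : R) (p%:R : R) (f p) => x y z; lra.
Qed.

Lemma choose_exponent (E d q : nat) (del : R) : (0 < E)%N -> 0 < del ->
  exists P, (0 < P)%N /\ forall p, (P <= p)%N -> exists n0, forall n, (n0 <= n)%N ->
    exists m, let k := (E * m).+1 in (k * p + k * d + q <= n)%N /\ (1 - del) * n%:R <= (k * p)%:R.
Proof.
move=> E0 del0.
have archi (x : R) : exists P, (0 < P)%N /\ x <= P%:R.
  exists (Num.truncn `|x|).+1; split=> //; apply: le_trans (ler_norm x) _.
  by apply/ltW/Num.Theory.truncnS_gt.
have [P [P0 HP]] := archi (2 * d%:R / del).
exists P; split=> // p Pp.
have p0 : (0 < p)%N by exact: leq_trans Pp.
have [n1 [n10 Hn1]] := archi (2 * (q + E * (p + d))%:R / del).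
exists (maxn n1 (q + p + d)) => n; rewrite geq_max => /andP[n1n qn].
pose m := ((n - (q + p + d)) %/ (E * (p + d)))%N; exists m => k.
have Epd : (0 < E * (p + d))%N by rewrite muln_gt0 E0 addn_gt0 p0.
have h1 : (k * p + k * d + q <= n)%N.
  have : (m * (E * (p + d)) <= n - (q + p + d))%N by exact: leq_trunc_div.
  by rewrite /k; nia.
split=> //.
have h2 : (n <= k * p + k * d + q + E * (p + d))%N.
  have : (n - (q + p + d) < m.+1 * (E * (p + d)))%N by rewrite -ltn_divLR.
  by rewrite /k; nia.
have Hd : d%:R <= p%:R * (del / 2).
  have : 2 * d%:R / del <= p%:R by apply: (le_trans HP); rewrite ler_nat.
  by rewrite ler_pdivrMr //; lra.
have Hq : (q + E * (p + d))%:R <= n%:R * (del / 2) :> R.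
  have : 2 * (q + E * (p + d))%:R / del <= n%:R by apply: (le_trans Hn1); rewrite ler_nat.
  by rewrite ler_pdivrMr //; lra.
have kpn : (k * p)%:R <= n%:R :> R by rewrite ler_nat; lia.
have kd : (k * d)%:R <= (k * p)%:R * (del / 2).
  by rewrite !natrM -mulrA; apply: ler_wpM2l.
have h2' : n%:R <= (k * p)%:R + (k * d)%:R + (q + E * (p + d))%:R :> R.
  by rewrite -!natrD ler_nat; lia.
have : (k * p)%:R * (del / 2) <= n%:R * (del / 2) by apply: ler_wpM2r => //; lra.
by lra.
Qed.

Theorem filtered_products_dim : exists d C : nat,
  (forall n (s : seq A), lin_free s -> (forall x, x \in s -> B n x) -> (size s <= C * n.+1 ^ d)%N) /\
  forall (t e : R), 0 < e -> exists P, (0 < P)%N /\ forall p, (P <= p)%N ->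
  exists n0, forall n, (n0 <= n)%N -> exists k : nat, [/\ (0 < k)%N, (1 - e) * n%:R <= (k * p)%:R,
    forall s : seq A, lin_free s -> (forall x, x \in s -> B p x) -> exists s' : seq A,
      [/\ lin_free s', forall x, x \in s' -> B n x & (k ^ d * size s <= size s')%N] &
    forall s : seq A, lin_free s -> (forall x, x \in s -> F p (p%:R * t) x) -> exists s' : seq A,
      [/\ lin_free s', forall x, x \in s' -> F n (n%:R * (t - e)) x & (k ^ d * size s <= size s')%N]].
Proof.
have [d [C [E [q [E0 [HC HE]]]]]] := graded_products_dim gB genB ftA intA kA.
exists d, C; split=> // t e e0.
have [N HN] := pseudo.
have [C1 C10 HC1] := lower_bound.
pose e1 := e / 12; have e10 : 0 < e1 by rewrite /e1; lra.
pose D := `|t| + C1; have D0 : 0 <= D by rewrite addr_ge0.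
pose del := Num.min e (e / (2 * (D + 1))).
have del0 : 0 < del by rewrite lt_min e0 divr_gt0 //; lra.
have [P1 [P10 HP1]] := power_bound e10.
have [P2 [P20 HP2]] := dyadic_small f0 fmono fcvg e10.
have [P3 [P30 HP3]] := choose_exponent d (q + N).+1 E0 del0.
exists (maxn P1 (maxn P2 (maxn P3 N))); split; first by rewrite leq_max P10.
move=> p; rewrite !geq_max => /and4P[P1p P2p P3p Np].
have p0 : (0 < p)%N by exact: leq_trans P1p.
have [n0 Hn0] := HP3 p P3p.
exists (maxn n0 P2) => n; rewrite geq_max => /andP[n0n P2n].
have n1 : (1 <= n)%N by exact: leq_trans P2n.
have [m /=] := Hn0 n n0n; set k := (E * m).+1 => -[kn kdel].
have k0 : (0 < k)%N by [].
exists k; split=> //.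
- apply: le_trans kdel; apply: ler_wpM2r => //; rewrite lerB // /del.
  by rewrite ge_min lexx.
- move=> s fs sB; have [||s' [fs' ss' Hs']] := HE n p m k erefl _ (B p) _ (fun _ => id) s fs sB.
  + by lia.
  + by case: gB => sB' _ _ _ _; exact: sB'.
  exists s'; split=> // x /Hs' [v [z [Bv Bz ->]]].
  rewrite -(@subnKC (k * p) n); last by lia.
  apply: (B_M gB) => //; elim: (k) => [|j IH]; first by rewrite expr0; exact: (B_1 gB).
  by rewrite exprS mulSn; apply: (B_M gB).
move=> s fs sF.
have [|||s' [fs' ss' Hs']] := HE n p m k erefl _ (F p (p%:R * t)) _ _ s fs sF.
- by lia.
- exact: F_sub.
- by move=> x; exact: F_B.
exists s'; split=> // x /Hs' [v [z [Fv Bz ->]]].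
pose r := (n - k * p)%N.
have rN : (N <= r)%N by rewrite /r; lia.
have r1 : (1 <= r)%N by rewrite /r; lia.
have kpN : (N <= k * p)%N by apply: leq_trans Np _; rewrite leq_pmull.
have nE : (k * p + r = n)%N by rewrite /r subnKC //; lia.
have := HN _ _ kpN rN _ _ _ _ (HP1 p k _ _ P1p k0 Fv) (HC1 r z r1 Bz).
rewrite nE; apply: F_anti => //.
have fn := HP2 n P2n.
have f1 : f (k * p)%N <= e1 * n%:R by apply: le_trans fn; apply: fmono; lia.
have f2 : f r <= e1 * n%:R by apply: le_trans fn; apply: fmono; lia.
have kpn : (k * p)%:R <= n%:R :> R by rewrite ler_nat; lia.
have nR : n%:R = (k * p)%:R + r%:R :> R by rewrite -natrD nE.
have rdel : r%:R <= del * n%:R by move: kdel nR; rewrite mulrBl; lra.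
have rD : r%:R * D <= e / 2 * n%:R.
  apply: (@le_trans _ _ (del * n%:R * D)); first exact: ler_wpM2r.
  apply: (@le_trans _ _ (e / (2 * (D + 1)) * n%:R * D)).
    by rewrite ler_wpM2r // ler_wpM2r // /del ge_min lexx orbT.
  rewrite (_ : e / (2 * (D + 1)) * n%:R * D = (e / 2 * n%:R) * (D / (D + 1))); last by field; lra.
  rewrite ler_piMr //; first by rewrite mulr_ge0 //; lra.
  by rewrite ler_pdivrMr; lra.
have e1k : 4 * e1 * (k * p)%:R <= 4 * e1 * n%:R by apply: ler_wpM2l => //; rewrite /e1; lra.
have rt : - (r%:R * t) <= r%:R * `|t| by rewrite -mulrN ler_wpM2l // -normrN ler_norm.
have rt' : r%:R * t <= r%:R * `|t| by rewrite ler_wpM2l // ler_norm.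
rewrite mulrA -natrM.
have -> : (k * p)%:R * t = n%:R * t - r%:R * t by rewrite nR; ring.
move: rD e1k f1 f2 rt'; rewrite /D /e1 mulrDr mulrBr.
have := mulr_ge0 (ltW e0) (ler0n R n).
by move: (n%:R : R) (r%:R : R) ((k * p)%:R : R) => x1 y1 u1; lra.
Qed.

End PseudoFiltered.

(** * Limits of tails *)

Section Limits.
Variable R : realType.

Lemma almost_increasing_cvg (u : nat -> R) (M : R) : (forall n, (0 < n)%N -> 0 <= u n <= M) ->
  (forall e : R, 0 < e -> exists P, (0 < P)%N /\ forall p, (P <= p)%N ->
     exists n0, forall n, (n0 <= n)%N -> u p - e <= u n) ->
  exists l : R, forall e : R, 0 < e -> exists P, forall n, (P <= n)%N -> `|u n - l| <= e.
Proof.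
move=> uM Hu; pose S := [set x | exists n0, forall n, (n0 <= n)%N -> x <= u n].
have S0 : S 0 by exists 1%N => n n1; have /andP[] := uM n n1.
have Sub : ubound S M.
  move=> x [n0 Hx]; have := Hx (maxn n0 1) (leq_maxl _ _) => /le_trans; apply.
  by have /andP[] := uM (maxn n0 1) (leq_maxr _ _).
have hS : has_sup S by split; [exists 0|exists M].
exists (sup S) => e e0.
have [x [n0 Hx] xe] := sup_adherent e0 hS.
have [P [P0 HP]] := Hu e e0.
exists (maxn n0 P) => n; rewrite geq_max => /andP[n0n Pn].
have : S (u n - e) by exact: HP.
move=> /(sup_upper_bound hS) h1; have h2 := Hx n n0n.
by rewrite ler_norml; lra.
Qed.

Lemma bernoulli_lower (e : R) d : 0 <= e <= 1 -> 1 - d%:R * e <= (1 - e) ^+ d.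
Proof.
move=> /andP[e0 e1]; elim: d => [|d IH]; first by rewrite expr0; lra.
rewrite exprS; apply: (@le_trans _ _ ((1 - e) * (1 - d%:R * e))).
  have : 0 <= d%:R * e * e by rewrite !mulr_ge0.
  by rewrite -natr1; lra.
by apply: ler_wpM2l => //; lra.
Qed.

Lemma dim_ratio_almost_increasing (b : nat -> nat) (D : nat -> R -> nat) (d C : nat) :
  (forall n, (0 < b n)%N) -> (forall n, (b n <= C * n.+1 ^ d)%N) ->
  (forall n r, (0 < n)%N -> (D n r <= b n)%N) ->
  (forall n r s, (0 < n)%N -> r <= s -> (D n s <= D n r)%N) ->
  (forall t e : R, 0 < e -> exists P, (0 < P)%N /\ forall p, (P <= p)%N ->
     exists n0, forall n, (n0 <= n)%N -> exists k : nat,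
     [/\ (0 < k)%N, (1 - e) * n%:R <= (k * p)%:R, (k ^ d * b p <= b n)%N &
       (k ^ d * D p (p%:R * t)%R <= D n (n%:R * (t - e))%R)%N]) ->
  forall t e : R, 0 < e -> exists P, (0 < P)%N /\ forall p, (P <= p)%N ->
     exists n0, forall n, (n0 <= n)%N ->
     (D p (p%:R * t))%:R / (b p)%:R - e <= (D n (n%:R * (t - e)))%:R / (b n)%:R :> R.
Proof.
move=> b0 bC Db Dmono main.
pose u n := (b n)%:R / n%:R ^+ d : R.
have key p n k x y (e : R) : (0 < p)%N -> (0 < n)%N -> 0 <= e <= 1 ->
    (1 - e) * n%:R <= (k * p)%:R -> (k ^ d * x <= y)%N ->
    (1 - d%:R * e) * (x%:R / p%:R ^+ d) <= y%:R / n%:R ^+ d.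
  move=> p0 n0 e01 kp xy.
  have nd0 : 0 < n%:R ^+ d :> R by rewrite exprn_gt0 ?ltr0n.
  have pd0 : 0 < p%:R ^+ d :> R by rewrite exprn_gt0 ?ltr0n.
  apply: (@le_trans _ _ ((1 - e) ^+ d * (x%:R / p%:R ^+ d))).
    by apply: ler_wpM2r; [rewrite divr_ge0 // ltW|exact: bernoulli_lower].
  rewrite ler_pdivlMr //.
  have -> : (1 - e) ^+ d * (x%:R / p%:R ^+ d) * n%:R ^+ d = ((1 - e) * n%:R) ^+ d * x%:R / p%:R ^+ d.
    by rewrite exprMn; ring.
  rewrite ler_pdivrMr //.
  apply: (@le_trans _ _ ((k * p)%:R ^+ d * x%:R)).
    apply: ler_wpM2r => //; apply: lerXn2r; rewrite ?nnegrE //.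
    by rewrite mulr_ge0 //; lra.
  rewrite natrM exprMn mulrAC; apply: ler_wpM2r; first exact: ltW.
  by rewrite -natrX -natrM ler_nat.
have [l Hl] : exists l : R, forall e : R, 0 < e -> exists P, forall n, (P <= n)%N -> `|u n - l| <= e.
  apply: (@almost_increasing_cvg u (C%:R * 2 ^+ d)).
    move=> n n0; rewrite divr_ge0 ?exprn_ge0 //= ler_pdivrMr ?exprn_gt0 ?ltr0n //.
    rewrite -mulrA -exprMn -natrM -natrX -natrM ler_nat; apply: leq_trans (bC n) _.
    rewrite leq_mul2l; apply/orP; right.
    by case: (posnP d) => [->//|d0]; rewrite leq_exp2r //; lia.
  move=> e e0.
  pose M := C%:R * 2 ^+ d : R.
  have M0 : 0 <= M by rewrite mulr_ge0 ?exprn_ge0.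
  have uM n : (0 < n)%N -> u n <= M.
    move=> n0; rewrite ler_pdivrMr ?exprn_gt0 ?ltr0n //.
    rewrite /M -mulrA -exprMn -natrM -natrX -natrM ler_nat; apply: leq_trans (bC n) _.
    rewrite leq_mul2l; apply/orP; right.
    by case: (posnP d) => [->//|d0]; rewrite leq_exp2r //; lia.
  pose e' := Num.min 1 (e / (d%:R * M + 1)).
  have dM0 : 0 <= d%:R * M by rewrite mulr_ge0.
  have e'0 : 0 < e' by rewrite lt_min ltr01 divr_gt0 //; lra.
  have e'1 : e' <= 1 by rewrite ge_min lexx.
  have [P [P0 HP]] := main 0 e' e'0; exists P; split=> // p Pp.
  have p0 : (0 < p)%N := leq_trans P0 Pp.
  have [n0 Hn0] := HP p Pp; exists (maxn n0 1) => n; rewrite geq_max => /andP[n0n n1].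
  have [k [k0 kp kb _]] := Hn0 n n0n.
  have e01 : 0 <= e' <= 1 by rewrite ltW.
  have := key p n k _ _ e' p0 n1 e01 kp kb; rewrite -/(u p) -/(u n).
  apply: le_trans; rewrite mulrBl mul1r lerB // mulrAC.
  apply: (@le_trans _ _ (d%:R * M * e')).
    by apply: ler_wpM2r; [exact: ltW|apply: ler_wpM2l => //; exact: uM].
  apply: (@le_trans _ _ (d%:R * M * (e / (d%:R * M + 1)))).
    by apply: ler_wpM2l => //; rewrite /e' ge_min lexx orbT.
  rewrite mulrCA ler_piMr //; first exact: ltW.
  by rewrite ler_pdivrMr; lra.
have [c c0 Hc] : exists2 c, 0 < c & exists P, forall n, (P <= n)%N -> c <= u n.
  have h0 : (0 : R) < (2 * (d%:R + 1))^-1 by rewrite invr_gt0; have := ler0n R d; lra.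
  pose e' := (2 * (d%:R + 1))^-1 : R.
  have [P [P0 HP]] := main 0 e' h0.
  have [n0 Hn0] := HP P (leqnn P).
  exists (u P / 2).
    by rewrite divr_gt0 // divr_gt0 ?ltr0n // exprn_gt0 ?ltr0n.
  exists (maxn n0 1) => n; rewrite geq_max => /andP[n0n n1].
  have [k [k0 kp kb _]] := Hn0 n n0n.
  have e1 : (d%:R + 1) * e' = 2^-1.
    by rewrite /e' invfM mulrCA divff ?mulr1 //; have := ler0n R d; lra.
  have de : 0 <= d%:R * e' by rewrite mulr_ge0 // ltW.
  have h0' : 0 < e' := h0.
  have e01 : 0 <= e' <= 1 by lra.
  have := key P n k _ _ e' P0 n1 e01 kp kb; rewrite -/(u P) -/(u n).
  apply: le_trans; rewrite mulrC ler_wpM2r //; last by lra.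
  by rewrite divr_ge0 // exprn_ge0.
move=> t e e0; have [e1|e1] := leP 1 e.
  exists 1%N; split=> // p p0; exists 1%N => n n0; apply: (@le_trans _ _ 0); last by rewrite divr_ge0.
  rewrite subr_le0; apply: le_trans e1; rewrite ler_pdivrMr ?ltr0n // mul1r ler_nat; exact: Db.
have [P1 HP1] := Hc.
have ec : 0 < e * c / 4 by rewrite divr_gt0 // mulr_gt0.
have [P2 HP2] := Hl _ ec.
have d0 := ler0n R d.
pose e' := Num.min 1 (e / (2 * (d%:R + 1))).
have e'0 : 0 < e' by rewrite lt_min ltr01 divr_gt0 //; lra.
have e'1 : e' <= 1 by rewrite ge_min lexx.
have de' : d%:R * e' <= e / 2.
  apply: (@le_trans _ _ (d%:R * (e / (2 * (d%:R + 1))))).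
    by apply: ler_wpM2l => //; rewrite /e' ge_min lexx orbT.
  rewrite mulrA ler_pdivrMr; last by lra.
  by have := ltW e0; nra.
have e'e : e' <= e.
  apply: (@le_trans _ _ (e / (2 * (d%:R + 1)))); first by rewrite /e' ge_min lexx orbT.
  rewrite ler_pdivrMr; last by lra.
  have h : 0 <= e * d%:R by rewrite mulr_ge0 // ltW.
  by lra.
have [P [P0 HP]] := main t e' e'0.
exists (maxn P (maxn P1 P2)); split; first by rewrite leq_max P0.
move=> p; rewrite !geq_max => /and3P[Pp P1p P2p].
have p0 : (0 < p)%N := leq_trans P0 Pp.
have [n0 Hn0] := HP p Pp.
exists (maxn (maxn n0 1) (maxn P1 P2)) => n; rewrite !geq_max => /andP[/andP[n0n n1] /andP[P1n P2n]].
have [k [k0 kp _ kD]] := Hn0 n n0n.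
have e01 : 0 <= e' <= 1 by rewrite ltW.
have K := key p n k _ _ e' p0 n1 e01 kp kD.
have nd0 : 0 < n%:R ^+ d :> R by rewrite exprn_gt0 ?ltr0n.
have pd0 : 0 < p%:R ^+ d :> R by rewrite exprn_gt0 ?ltr0n.
have bn0 : 0 < (b n)%:R :> R by rewrite ltr0n.
have bp0 : 0 < (b p)%:R :> R by rewrite ltr0n.
have un : c <= u n := HP1 n P1n.
have unp : u n * (1 - e / 2) <= u p.
  have := HP2 n P2n; have := HP2 p P2p; rewrite !ler_norml => /andP[h1 h2] /andP[h3 h4].
  have : e / 2 * c <= e / 2 * u n by apply: ler_wpM2l => //; lra.
  by lra.
have Dmn : (D n (n%:R * (t - e')))%:R <= (D n (n%:R * (t - e)))%:R :> R.
  by rewrite ler_nat; apply: Dmono => //; apply: ler_wpM2l => //; lra.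
apply: (@le_trans _ _ ((D n (n%:R * (t - e')))%:R / (b n)%:R)); last first.
  by apply: ler_wpM2r => //; rewrite invr_ge0 ltW.
set G := (D p (p%:R * t))%:R / (b p)%:R.
have G0 : 0 <= G by rewrite divr_ge0.
have G1 : G <= 1 by rewrite ler_pdivrMr // mul1r ler_nat; exact: Db.
have EG : (D p (p%:R * t))%:R / p%:R ^+ d = G * u p by rewrite /G /u; field; rewrite !gt_eqF.
rewrite EG in K.
have un0 : 0 < u n by lra.
have En : (D n (n%:R * (t - e')))%:R / n%:R ^+ d = (D n (n%:R * (t - e')))%:R / (b n)%:R * u n.
  by rewrite /u; field; rewrite !gt_eqF.
rewrite En in K; rewrite -(ler_pM2r un0); apply: le_trans K.
have h1 : (1 - e / 2) * (G * (u n * (1 - e / 2))) <= (1 - d%:R * e') * (G * u p).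
  have e2 : 0 <= 1 - e / 2 by lra.
  have un2 : 0 <= u n * (1 - e / 2) by rewrite mulr_ge0 // ltW.
  by apply: ler_pM; [|exact: mulr_ge0|lra|exact: ler_wpM2l].
apply: le_trans h1; rewrite (_ : _ * (G * _) = (1 - e / 2) * (1 - e / 2) * G * u n); last by ring.
apply: ler_wpM2r; first exact: ltW.
have : 0 <= e * (1 - G) by apply: mulr_ge0; lra.
have : 0 <= e * e * G by rewrite mulr_ge0 // mulr_ge0 // ltW.
by lra.
Qed.

End Limits.

Section LimitTail.
Variable R : realType.

Lemma limit_tail (G : nat -> R -> R) (a b : R) :
  (forall n t, (0 < n)%N -> 0 <= G n t <= 1) ->
  (forall n s t, (0 < n)%N -> s <= t -> G n t <= G n s) ->
  (forall n t, (0 < n)%N -> t <= a -> G n t = 1) ->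
  (forall n t, (0 < n)%N -> b < t -> G n t = 0) ->
  (forall t e : R, 0 < e -> exists P, (0 < P)%N /\ forall p, (P <= p)%N ->
     exists n0, forall n, (n0 <= n)%N -> G p t - e <= G n (t - e)) ->
  exists T : R -> R, [/\ forall s t, s <= t -> T t <= T s,
    forall t e : R, 0 < e -> exists2 s, t < s & T t - e <= T s,
    forall t, t < a -> T t = 1, forall t, b <= t -> T t = 0 &
    forall s t e : R, s < t -> 0 < e -> exists P, forall n, (P <= n)%N -> T t - e <= G n t <= T s + e].
Proof.
move=> G01 Gmono Ga Gb HG.
pose S t := [set x | exists n0, forall n, (n0 <= n)%N -> x <= G n t].
have S0 t : S t 0 by exists 1%N => n n1; case/andP: (G01 n t n1).
have hS t : has_sup (S t).
  split; [by exists 0|exists 1 => x [n0 Hx]].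
  apply: le_trans (Hx (maxn n0 1) (leq_maxl _ _)) _.
  by case/andP: (G01 (maxn n0 1) t (leq_maxr _ _)).
pose H t := sup (S t).
have Hmono s t : s <= t -> H t <= H s.
  move=> st; apply: ge_sup; first by exists 0.
  move=> x [n0 Hx]; apply: sup_upper_bound => //; exists (maxn n0 1) => n.
  rewrite geq_max => /andP[n0n n1]; apply: le_trans (Hx n n0n) _; exact: Gmono.
have H0 t : 0 <= H t by apply: sup_upper_bound.
have H1 t : H t <= 1.
  apply: ge_sup; first by exists 0.
  move=> x [n0 Hx]; apply: le_trans (Hx (maxn n0 1) (leq_maxl _ _)) _.
  by case/andP: (G01 (maxn n0 1) t (leq_maxr _ _)).
have Ha t : t <= a -> H t = 1.
  move=> ta; apply/eqP; rewrite eq_le H1 /=; apply: sup_upper_bound => //.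
  by exists 1%N => n n1; rewrite Ga.
have Hb t : b < t -> H t = 0.
  move=> ta; apply/eqP; rewrite eq_le H0 andbT; apply: ge_sup; first by exists 0.
  by move=> x [n0 /(_ (maxn n0 1) (leq_maxl _ _))]; rewrite Gb // leq_maxr.
have Hlo t e : 0 < e -> exists P, forall n, (P <= n)%N -> H t - e <= G n t.
  move=> e0; have [x [n0 Hx] xe] := sup_adherent e0 (hS t).
  by exists n0 => n n0n; apply: le_trans (Hx n n0n); exact: ltW.
have Hup t e : 0 < e -> exists P, forall n, (P <= n)%N -> G n t <= H (t - e) + e.
  move=> e0; have [P [P0 HP]] := HG t e e0; exists P => p Pp.
  by rewrite -lerBlDr; apply: sup_upper_bound => //; exact: HP.
pose U t := [set H s | s in [set s | t < s]].
have U0 t : U t (H (t + 1)) by exists (t + 1) => //=; rewrite ltrDl.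
have hU t : has_sup (U t).
  by split; [exists (H (t + 1))|exists 1 => _ [s _ <-]].
pose T t := sup (U t).
have HT s t : s < t -> H t <= T s by move=> st; apply: sup_upper_bound => //; exists t.
have TH t : T t <= H t.
  by apply: ge_sup; [exists (H (t + 1))|move=> _ [s /= ts <-]; apply/Hmono/ltW].
exists T; split.
- move=> s t st; apply: ge_sup; first by exists (H (t + 1)).
  move=> _ [u /= tu <-]; apply: HT; exact: le_lt_trans tu.
- move=> t e e0; have [_ [u /= tu <-] Hu] := sup_adherent e0 (hU t).
  exists ((t + u) / 2); first by rewrite midf_lt.
  by apply: (le_trans (ltW Hu)); apply: HT; rewrite midf_lt.
- move=> t ta; apply/eqP; rewrite eq_le (le_trans (TH t)) //=.
  by rewrite -(Ha a (lexx a)); exact: HT.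
- move=> t bt; apply/eqP; rewrite eq_le; apply/andP; split.
    apply: ge_sup; first by exists (H (t + 1)).
    by move=> _ [u /= tu <-]; rewrite Hb // (le_lt_trans bt).
  by apply: le_trans (HT t (t + 1) _); rewrite ?ltrDl.
- move=> s t e st e0.
  have [P1 HP1] := Hlo t e e0.
  pose e' := Num.min e ((t - s) / 2).
  have e'0 : 0 < e' by rewrite lt_min e0 divr_gt0 // subr_gt0.
  have e'e : e' <= e by rewrite ge_min lexx.
  have e't : e' <= (t - s) / 2 by rewrite ge_min lexx orbT.
  have [P2 HP2] := Hup t e' e'0.
  exists (maxn P1 P2) => n; rewrite geq_max => /andP[P1n P2n]; apply/andP; split.
    by apply: le_trans (HP1 n P1n); rewrite lerB.
  apply: le_trans (HP2 n P2n) _; apply: lerD => //; apply: HT; lra.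
Qed.

End LimitTail.

Section TailMeasure.
Variable R : realType.

Section Build.
Variables (T : R -> R) (a b : R).
Hypotheses (Tmono : forall s t, s <= t -> T t <= T s)
  (Trc : forall t e : R, 0 < e -> exists2 s, t < s & T t - e <= T s)
  (Ta : forall t, t < a -> T t = 1) (Tb : forall t, b <= t -> T t = 0).

Let F t := 1 - T t.
Let F_nd : nondecreasing F.
Proof. by move=> s t st; rewrite /F lerB // Tmono. Qed.
Let F_rc : right_continuous F.
Proof.
move=> t; apply/cvgrPdist_le => e e0; have [s ts Hs] := Trc t e0.
near=> u; have tu : t < u by near: u; exact: nbhs_right_gt.
have us : u <= s by near: u; exact: nbhs_right_le.
have h1 := Tmono us; have h2 := Tmono (ltW tu).
by rewrite /F ler_norml; apply/andP; split; lra.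
Unshelve. all: by end_near. Qed.
HB.instance Definition _ := isCumulative.Build R _ R F F_nd F_rc.
Let F_Ny : F @ -oo --> (0 : R).
Proof.
apply/cvgrPdist_le => e e0; near=> u.
have ua : u < a by near: u; exact: (nbhs_ninfty_lt (num_real a)).
by rewrite /F Ta // !subrr normr0 ltW.
Unshelve. all: by end_near. Qed.
Let F_y : F @ +oo --> (1 : R).
Proof.
apply/cvgrPdist_le => e e0; near=> u.
have ub : b <= u by near: u; exact: (nbhs_pinfty_ge (num_real b)).
by rewrite /F Tb // subr0 subrr normr0 ltW.
Unshelve. all: by end_near. Qed.
HB.instance Definition _ := isCumulativeBounded.Build R 0 1 F F_Ny F_y.

Let idTR : measurableTypeR R -> R := idfun.
#[local] HB.instance Definition _ :=
  @isMeasurableFun.Build _ _ _ _ idTR (@measurable_id _ _ setT).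

Lemma tail_measure : exists nu : probability R R, forall t, nu `]t, +oo[%classic = (T t)%:E.
Proof.
pose P : probability (measurableTypeR R) R := lebesgue_stieltjes_measure F.
pose nu : probability R R := distribution P idTR.
exists nu => t.
have H : nu `]-oo, t]%classic = (F t)%:E by exact: cdf_lebesgue_stieltjes_id.
have -> : `]t, +oo[%classic = ~` `]-oo, t]%classic by rewrite setCitvl.
rewrite probability_setC //; rewrite [X in (_ - X)%E]H /F -EFinB; congr EFin; ring.
Qed.
End Build.
End TailMeasure.

(** * Vague convergence *)

Section Vague.
Variable R : realType.

Lemma heine (phi : R -> R) (M e : R) : continuous phi -> 0 < e ->
  exists2 del : R, 0 < del & forall x y, `|x| <= M -> `|x - y| < del -> `|phi x - phi y| <= e.
Proof.
move=> cphi e0.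
have := @segment_compact R (- M) M; rewrite compact_near_coveringP => cov.
have [|del /= del0 Hdel] := cov _ (0 : R)^'+ (fun del x => forall y, `|x - y| < del -> `|phi x - phi y| <= e) _ _.
  move=> x _; have e20 : 0 < e / 2 by rewrite divr_gt0.
  have /cvgrPdist_lt /(_ _ e20) [r /= r0 Hr] := cphi x.
  have r20 : 0 < r / 2 by rewrite divr_gt0.
  exists (ball x (r / 2), [set d | d < r / 2]) => /=.
    by split; [exact: nbhsx_ballx|exact: nbhs_right_lt].
  move=> [x' d] /= [xx' dr] y x'y.
  have h1 : `|x - x'| < r / 2 by exact: xx'.
  have h2 : `|x - y| < r.
    rewrite (_ : x - y = (x - x') + (x' - y)); last by ring.
    by apply: (le_lt_trans (ler_normD _ _)); lra.
  have h3 := Hr x' (lt_trans h1 _); have h4 := Hr y h2.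
  rewrite (_ : phi x' - phi y = - (phi x - phi x') + (phi x - phi y)); last by ring.
  apply: (le_trans (ler_normD _ _)); rewrite normrN.
  have : `|phi x - phi x'| < e / 2 by apply: h3; lra.
  by move: h4 => /=; lra.
exists (del / 2); first by rewrite divr_gt0.
move=> x y xM xy; apply: (Hdel (del / 2)) xy; rewrite //=.
- by rewrite sub0r normrN gtr0_norm ?divr_gt0 //; lra.
- by rewrite divr_gt0.
- by rewrite in_itv /= -ler_norml.
Qed.

Lemma uniformly_continuous_compact_support (phi : R -> R) : continuous phi ->
  compact (closure [set x | phi x != 0%R]) ->
  exists M : R, 0 <= M /\ (forall x, M < `|x| -> phi x = 0) /\
   forall e : R, 0 < e -> exists2 del : R, 0 < del & forall x y, `|x - y| < del -> `|phi x - phi y| <= e.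
Proof.
move=> cphi /compact_bounded [M0 [_ HM0]].
pose M := `|M0| + 1.
have HM x : M < `|x| -> phi x = 0.
  move=> Mx; apply/eqP; apply: contraTT Mx => px; rewrite -leNgt.
  apply: HM0; last exact: subset_closure.
  by rewrite /M (le_lt_trans (ler_norm M0)) // ltrDl.
exists M; split; first by rewrite addr_ge0.
split=> // e e0; have [del del0 Hdel] := heine M cphi e0; exists del => // x y xy.
have [xM|/HM px] := leP `|x| M; first exact: Hdel.
have [yM|/HM py] := leP `|y| M; first by rewrite distrC; apply: Hdel => //; rewrite distrC.
by rewrite px py subrr normr0 ltW.
Qed.

Lemma step_sum (phi : R -> R) (s : nat -> R) m x : (forall i, s i < s i.+1) ->
  exists j, [/\ (j <= m)%N, j = 0%N \/ s j <= x, j = m \/ x < s j.+1 &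
   \sum_(i < m) (phi (s i.+1) - phi (s i)) * \1_(`[s i.+1, +oo[%classic) x = phi (s j) - phi (s 0%N)].
Proof.
move=> si; have smono i j : (i <= j)%N -> s i <= s j.
  by move=> /subnK <-; elim: (j - i)%N => // k IH; rewrite addSn (le_trans IH) // ltW.
elim: m => [|m [j [jm js jx IH]]].
  by exists 0%N; split=> //; [left|left|rewrite big_ord0 subrr].
have [sx|xs] := leP (s m.+1) x.
  have Ej : j = m.
    by case: jx => // xj; move: (lt_le_trans xj (smono j.+1 m.+1 jm)); rewrite ltNge sx.
  exists m.+1; split=> //; [by right|by left|].
  rewrite big_ord_recr /= IH Ej indicE mem_set ?mulr1 ?subrKA /=; last by rewrite in_itv /= sx.
  by ring.
exists j; split=> //; first exact: leqW.
  by case: jx => [->|]; right.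
rewrite big_ord_recr /= IH indicE memNset ?mulr0 ?addr0 //=.
by rewrite in_itv /= andbT; apply/negP; rewrite -ltNge.
Qed.

Lemma step_integral (mu : {measure set R -> \bar R}) m (t a : nat -> R) (phi : R -> R) (eta : R) :
  mu setT = 1%E -> continuous phi ->
  (forall x, `|phi x - \sum_(i < m) a i * \1_(`[t i, +oo[%classic) x| <= eta) ->
  exists2 I : R, (\int[mu]_x (phi x)%:E)%E = I%:E &
    `|I - \sum_(i < m) a i * fine (mu `[t i, +oo[%classic)| <= eta.
Proof.
move=> mu1 cphi Hphi.
have mul : (mu setT < +oo)%E by rewrite mu1 ltry.
pose g i x := a i * \1_(`[t i, +oo[%classic) x : R.
have mg i : measurable_fun setT (g i).
  by apply: measurable_funM => //; exact: measurable_indic.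
have g_le i x : `|g i x| <= `|a i|.
  rewrite /g normrM ler_piMr // indicE; case: (_ \in _); rewrite /= ?normr1 ?normr0 //.
have bint (h : R -> R) C : measurable_fun setT h -> (forall x, `|h x| <= C) ->
    mu.-integrable setT (EFin \o h).
  move=> mh hC; apply: measurable_bounded_integrable => //.
  by exists C; split; [exact: num_real|move=> y Cy x _; exact: le_trans (hC x) (ltW Cy)].
have ig i : mu.-integrable setT (EFin \o g i) by exact: bint (g_le i).
pose psi x := \sum_(i < m) g i x.
have ipsi : mu.-integrable setT (EFin \o psi).
  rewrite (_ : EFin \o psi = fun x => (\sum_(i < m) (EFin \o g i) x)%E); last first.
    by apply/funext => x; rewrite /psi /= sumEFin.
  by apply: integrable_sum => // i _.
have psi_le x : `|psi x| <= \sum_(i < m) `|a i|.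
  by apply: (le_trans (ler_norm_sum _ _ _)); apply: ler_sum => i _; exact: g_le.
have mphi : measurable_fun setT phi by exact: continuous_measurable_fun.
have iphi : mu.-integrable setT (EFin \o phi).
  apply: (bint _ (eta + \sum_(i < m) `|a i|)) => // x.
  rewrite -(subrK (psi x) (phi x)); apply: (le_trans (ler_normD _ _)).
  by apply: lerD; [exact: Hphi|exact: psi_le].
have Ipsi : (\int[mu]_x (psi x)%:E)%E = (\sum_(i < m) a i * fine (mu `[t i, +oo[%classic))%:E.
  under eq_integral do rewrite /psi -sumEFin.
  rewrite integral_sum //; last by move=> i; exact: ig.
  rewrite -sumEFin; apply: eq_bigr => i _.
  under eq_integral do rewrite /g EFinM.
  rewrite integralZl //; last first.
    apply: (bint _ 1); first exact: measurable_indic.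
    by move=> x; rewrite indicE; case: (_ \in _); rewrite /= ?normr1 ?normr0.
  rewrite integral_indic // setIT EFinM fineK //.
  rewrite ge0_fin_numE // (le_lt_trans _ mul) //; apply: le_measure; rewrite ?inE //.
exists (fine (\int[mu]_x (phi x)%:E)%E).
  by rewrite fineK //; exact: integrable_fin_num iphi.
have fphi : (\int[mu]_x (phi x)%:E)%E \is a fin_num by exact: integrable_fin_num iphi.
rewrite -lee_fin -abse_EFin EFinB fineK // -Ipsi -integralB_EFin //.
apply: (@le_trans _ _ (\int[mu]_x `|(phi x)%:E - (psi x)%:E|)%E).
  apply: le_abse_integral => //.
  have := integrableB measurableT iphi ipsi; by move=> /integrableP[].
rewrite -(mule1 eta%:E) -mu1 -integral_cst //.
apply: ge0_le_integral => //.
- apply: measurableT_comp => //.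
  have := integrableB measurableT iphi ipsi; by move=> /integrableP[].
- by move=> x _; rewrite lee_fin; exact: le_trans (Hphi x).
Qed.

Lemma vague_of_tails (mus : nat -> {measure set R -> \bar R}) (nu : probability R R) (T : R -> R) :
  (forall n, mus n setT = 1%E) ->
  (forall t, nu `]t, +oo[%classic = (T t)%:E) ->
  (forall s t e : R, s < t -> 0 < e -> exists P, forall n, (P <= n)%N ->
     ((T t - e)%:E <= mus n `[t, +oo[%classic <= (T s + e)%:E)%E) ->
  vague_cvg mus nu.
Proof.
move=> mus1 nuT HT phi cphi csupp.
have [M [M0 [HM uc]]] := uniformly_continuous_compact_support cphi csupp.
have nu1 : nu setT = 1%E by exact: probability_setT.
have T0 t : 0 <= T t by rewrite -lee_fin -nuT.
have T1 t : T t <= 1 by rewrite -lee_fin -nuT; exact: probability_le1.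
have approx (e : R) : 0 < e -> exists (s : nat -> R) (m : nat),
   (forall i, s i < s i.+1) /\ (forall i, `|phi (s i.+1) - phi (s i)| <= e) /\
   forall x, `|phi x - \sum_(i < m) (phi (s i.+1) - phi (s i)) * \1_(`[s i.+1, +oo[%classic) x| <= e.
  move=> e0; have [del del0 Hdel] := uc e e0.
  pose h : R := del / 2; have h0 : 0 < h by rewrite divr_gt0.
  pose m := (Num.truncn `|(2 * M + 4) / h|).+1.
  have mh : 2 * M + 4 < m%:R * h.
    rewrite -ltr_pdivrMr //; apply: (le_lt_trans (ler_norm _)); exact: Num.Theory.truncnS_gt.
  pose s (i : nat) : R := - (M + 2) + i%:R * h; exists s, m.
  have ss i : s i.+1 = s i + h by rewrite /s -natr1; ring.
  have hdel : h < del by rewrite /h; lra.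
  split; first by move=> i; rewrite ss ltrDl.
  split.
    move=> i; apply: Hdel; rewrite ss (_ : _ - _ = h); last by ring.
    by rewrite gtr0_norm.
  move=> x; have [|j [jm js jx ->]] := @step_sum phi s m x; first by move=> i; rewrite ss ltrDl.
  have s0 : s 0%N = - (M + 2) by rewrite /s mul0r addr0.
  have sm : M + 2 < s m by rewrite /s; lra.
  have p0 : phi (s 0%N) = 0 by apply: HM; rewrite s0 normrN ger0_norm; lra.
  rewrite p0 subr0.
  have [xs0|s0x] := ltP x (s 0%N).
    have j0 : j = 0%N.
      case: js => // sjx; have : s 0%N <= s j by rewrite s0 /s lerDl mulr_ge0 // ltW.
      by move=> h1; exfalso; lra.
    rewrite j0 p0 HM ?subrr ?normr0 ?ltW //.
    by rewrite ler0_norm; rewrite s0 in xs0; lra.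
  have sjx : s j <= x by case: js => [->|].
  case: jx => [jm'|xj].
    rewrite jm' in sjx *; rewrite !HM ?subrr ?normr0 ?ltW //; rewrite ger0_norm; lra.
  by apply: Hdel; rewrite ger0_norm ?subr_ge0 //; move: xj; rewrite ss; lra.
have int (mu : {measure set R -> \bar R}) : mu setT = 1%E ->
    exists I : R, (\int[mu]_x (phi x)%:E)%E = I%:E.
  move=> mu1; have [s [m [_ [_ H]]]] := approx 1 ltr01.
  by have [I -> _] := @step_integral mu m (fun i => s i.+1) (fun i => phi (s i.+1) - phi (s i)) _ _ mu1 cphi H; exists I.
have /choice [I HI] : forall n, exists I : R, (\int[mus n]_x (phi x)%:E)%E = I%:E.
  by move=> n; exact: int (mus1 n).
have [I0 HI0] := int nu nu1.
rewrite HI0 (_ : (fun n => _) = EFin \o I); last by apply/funext => n /=; rewrite HI.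
apply/fine_cvgP; split; first by apply: nearW.
apply/cvgrPdist_le => e e0.
have e40 : 0 < e / 4 by rewrite divr_gt0.
(* The increments of phi are at most e / 4 and those of T telescope, so the nodes s_i need not be
   continuity points of T. *)
have [s [m [ss [Ha Hpsi]]]] := approx _ e40.
pose a i := phi (s i.+1) - phi (s i).
pose e' := (m.+1%:R)^-1 : R.
have e'0 : 0 < e' by rewrite invr_gt0.
have /choice [P HP] : forall i, exists P, forall n, (P <= n)%N ->
     ((T (s i.+1) - e')%:E <= mus n `[s i.+1, +oo[%classic <= (T (s i) + e')%:E)%E.
  by move=> i; exact: HT.
exists (\max_(i < m) P i) => // n /= Pn.
have [I' HI' hI] := @step_integral _ m (fun i => s i.+1) a _ _ (mus1 n) cphi Hpsi.
have {HI' I'} hI : `|I n - \sum_(i < m) (phi (s i.+1) - phi (s i)) * fine (mus n `[s i.+1, +oo[%classic)| <= e / 4.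
  by move: HI'; rewrite HI => -[->].
have [I' HI' hI0] := @step_integral _ m (fun i => s i.+1) a _ _ nu1 cphi Hpsi.
have {HI' I'} hI0 : `|I0 - \sum_(i < m) (phi (s i.+1) - phi (s i)) * fine (nu `[s i.+1, +oo[%classic)| <= e / 4.
  by move: HI'; rewrite HI0 => -[->].
pose A := \sum_(i < m) (phi (s i.+1) - phi (s i)) * fine (mus n `[s i.+1, +oo[%classic).
pose A0 := \sum_(i < m) (phi (s i.+1) - phi (s i)) * fine (nu `[s i.+1, +oo[%classic).
rewrite -/A in hI; rewrite -/A0 in hI0.
have AA0 : `|A0 - A| <= e / 4 * 2.
  rewrite /A0 /A -sumrB; apply: (le_trans (ler_norm_sum _ _ _)).
  apply: (@le_trans _ _ (\sum_(i < m) e / 4 * (T (s i) - T (s i.+1) + e'))).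
    apply: ler_sum => i _; rewrite -mulrBr normrM; apply: ler_pM => //.
    have := HP i n (leq_trans (leq_bigmax i) Pn).
    have nufin : nu `[s i.+1, +oo[%classic \is a fin_num by exact: fin_num_measure.
    have musfin : mus n `[s i.+1, +oo[%classic \is a fin_num.
      rewrite ge0_fin_numE //; apply: (@le_lt_trans _ _ (mus n setT)); last by rewrite mus1 ltry.
      by apply: le_measure; rewrite ?inE.
    have n1 : (nu `]s i.+1, +oo[%classic <= nu `[s i.+1, +oo[%classic)%E.
      by apply: le_measure; rewrite ?inE // => x /=; rewrite !in_itv /= !andbT => /ltW.
    have n2 : (nu `[s i.+1, +oo[%classic <= nu `]s i, +oo[%classic)%E.
      by apply: le_measure; rewrite ?inE // => x /=; rewrite !in_itv /= !andbT; exact: lt_le_trans.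
    rewrite nuT in n1; rewrite nuT in n2; move: n1 n2.
    rewrite -(fineK nufin) -(fineK musfin) !lee_fin /= => n1 n2 /andP[n3 n4].
    by rewrite ler_norml; apply/andP; split; lra.
  rewrite -mulr_sumr; apply: ler_wpM2l; first exact: ltW.
  rewrite big_split /=.
  rewrite (_ : \sum_(i < m) (T (s i) - T (s i.+1)) = T (s 0%N) - T (s m)); last first.
    elim: (m) => [|k IH]; first by rewrite big_ord0 subrr.
    by rewrite big_ord_recr /= IH; ring.
  rewrite sumr_const card_ord -[e' *+ m]mulr_natr.
  have : e' * m%:R <= 1 by rewrite mulrC ler_pdivrMr ?mul1r ?ler_nat.
  by have h1 := T1 (s 0%N); have h2 := T0 (s m); lra.
have -> : I0 - I n = (I0 - A0) + (A0 - A) - (I n - A) by ring.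
apply: (le_trans (ler_normB _ _)); have := ler_normD (I0 - A0) (A0 - A); lra.
Qed.

End Vague.

Section UpperBound.
Variables (R : realType) (K : fieldType) (A : lmodType K)
  (B : nat -> A -> Prop) (F : nat -> R -> A -> Prop).
Hypotheses (gF : forall n, (1 <= n)%N -> good_filtration (B n) (F n))
  (fdB : forall n, exists m, forall s : seq A, (forall x, x \in s -> B n x) -> lin_free s -> (size s <= m)%N)
  (limB : (limn_esup (fun n : nat =>
     ereal_sup [set (flambda (F n) a * ((n%:R)^-1)%R%:E)%E
               | a in [set a | B n a /\ a <> 0%R]]) < +oo)%E).

Lemma eventual_upper_bound : exists (M : R) n0, forall n s a, (n0 <= n)%N -> (1 <= n)%N ->
  B n a -> a <> 0 -> F n s a -> s <= M * n%:R.
Proof.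
move: limB; set u := (fun n : nat => _) => /ereal_inf_lt [_ [Y [n0 _ n0Y] <-]] Yoo.
have [M HM] : exists M : R, (ereal_sup (u @` Y) <= M%:E)%E.
  case: (ereal_sup _) Yoo => [r _|//|_]; first by exists r.
  by exists 0; rewrite leNye.
exists M, n0 => n s a n0n n1 Ba a0 Fa.
have nR0 : 0 < n%:R :> R by rewrite ltr0n.
rewrite -ler_pdivrMr // -lee_fin; apply: le_trans HM.
apply: (@le_trans _ _ (u n)); last first.
  by apply: ereal_sup_ubound; exists n => //; exact: n0Y.
apply: (@le_trans _ _ (flambda (F n) a * ((n%:R)^-1)%R%:E)%E); last first.
  have H := @ereal_sup_ubound R [set (flambda (F n) a * ((n%:R)^-1)%R%:E)%E | a in [set a | B n a /\ a <> 0%R]].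
  by apply: H; exists a.
rewrite EFinM; apply: lee_wpmul2r; first by rewrite lee_fin invr_ge0 ltW.
by rewrite /flambda; apply: ereal_sup_ubound; exists s.
Qed.

Lemma upper_bound : exists C2 : R, forall n s a, (1 <= n)%N ->
  B n a -> a <> 0 -> F n s a -> s <= C2 * n%:R.
Proof.
have [M [n0 HM]] := eventual_upper_bound.
have /choice [s Hs] : forall n, exists s : R, (1 <= n)%N -> forall b, F n s b -> b = 0.
  move=> n; have [n1|] := leqP 1 n; last by exists 0.
  have [m Hm] := fdB n; have [s Hs] := filtration_trivial (gF n1) Hm.
  by exists s.
pose c := \sum_(i < n0) `|s i|.
have c0 : 0 <= c by apply: sumr_ge0.
exists (`|M| + c) => n t a n1 Ba a0 Fa.
have nR1 : 1 <= n%:R :> R by rewrite ler1n.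
have [n0n|nn0] := leqP n0 n.
  apply: (le_trans (HM n t a n0n n1 Ba a0 Fa)); apply: ler_wpM2r => //.
  by have := ler_norm M; lra.
have ts : t <= s n.
  rewrite leNgt; apply/negP => /ltW st; apply: a0; apply: (Hs n n1).
  by case: (gF n1) => _ anti _ _ _; exact: anti st Fa.
have sc : `|s n| <= c.
  by rewrite /c (bigD1 (Ordinal nn0)) //= lerDl sumr_ge0.
have := ler_norm (s n); have : 0 <= `|M| * n%:R by rewrite mulr_ge0.
have : c * 1 <= c * n%:R by apply: ler_wpM2l.
by lra.
Qed.

End UpperBound.

Theorem mainTheorem20 (R : realType) (K : fieldType) (A : comAlgType K)
  (f : nat -> R)
  (B : nat -> A -> Prop) (F : nat -> R -> A -> Prop)
  (mu : nat -> probability R R) :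
  (* f : Z_{>=0} -> R_{>=0} increasing, with sum_a f(2^a)/2^a < +oo *)
  (forall n, 0 <= f n) ->
  (forall n m, (n <= m)%N -> f n <= f m) ->
  cvgn (series (fun a : nat => f (2 ^ a)%N / (2 ^ a)%:R)) ->
  (* B = ⊕ B_n integral graded K-algebra of finite type generated by B_1 *)
  graded_alg B -> integral_alg A -> finite_type_alg A -> generated_by (B 1%N) ->
  (* (i) Krull dimension > 0 *)
  krull_dim_pos A ->
  (* (ii) filtrations and f-pseudo-filtered structure *)
  (forall n, (1 <= n)%N -> good_filtration (B n) (F n)) ->
  (exists N : nat, forall (n m : nat), (N <= n)%N -> (N <= m)%N ->
     forall (s t : R) (a b : A), F n s a -> F m t b ->
       F (n + m)%N (s + t - f n - f m) (a * b)) ->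
  (* (iii) limsup_n sup_{0 <> a in B_n} lambda(a)/n < +oo *)
  (limn_esup (fun n : nat =>
     ereal_sup [set (flambda (F n) a * ((n%:R)^-1)%R%:E)%E
               | a in [set a | B n a /\ a <> 0%R]]) < +oo)%E ->
  (* mu n = nu_{B_n} *)
  (forall n, (1 <= n)%N -> is_filtration_measure (B n) (F n) (mu n)) ->
  (* conclusion, with nu_n = T_{1/n} nu_{B_n} *)
  (exists a b : R, forall n, (1 <= n)%N ->
      msupport (Tscale (n%:R)^-1 (mu n)) `<=` `[a, b]) /\
  (exists nu : probability R R,
      vague_cvg (fun n => Tscale (n%:R)^-1 (mu n)) nu).
Proof.
move=> f0 fmono fcvg gB intA ftA genB kA gF pseudo limB muB.
have fdB := dim_bound gB intA ftA genB kA.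
have [C1 C10 HC1] := lower_bound f0 fmono fcvg gB intA ftA genB kA gF pseudo.
have [C2 HC2] := upper_bound gF fdB limB.
have [d [C [bC main]]] := filtered_products_dim f0 fmono fcvg gB intA ftA genB kA gF pseudo.
have FB n s a : (1 <= n)%N -> F n s a -> B n a by exact: (F_B gF).
have Fanti n s t a : (1 <= n)%N -> s <= t -> F n t a -> F n s a by exact: (F_anti gF).
have /choice [b Hb] : forall n, exists d, has_dim (B n) d.
  by move=> n; have [m /has_dim_exists] := fdB n.
have /choice [D' HD'] : forall x : nat * R, exists d, (1 <= x.1)%N -> has_dim (F x.1 x.2) d.
  move=> [n r] /=; have [n1|] := leqP 1 n; last by exists 0%N.
  have [m Hm] := fdB n; have [|e He] := @has_dim_exists _ _ (F n r) m.
    by move=> s sF; apply: Hm => x /sF; exact: FB.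
  by exists e.
pose D n r := D' (n, r).
have HD n r : (1 <= n)%N -> has_dim (F n r) (D n r) by exact: (HD' (n, r)).
have dim_le (W W' : A -> Prop) e e' : has_dim W e -> has_dim W' e' ->
    (forall x, W x -> W' x) -> (e <= e')%N.
  by move=> [[s [<- [sW fs]]] _] [_ H] WW'; apply: H => // x /sW /WW'.
have b0 n : (0 < b n)%N.
  have [x Bx x0] := krull_B1 gB genB kA.
  have Bxn : B n (x ^+ n).
    elim: n => [|n IH]; first by rewrite expr0; exact: (B_1 gB).
    by rewrite exprS -add1n; apply: (B_M gB).
  have xn0 : x ^+ n <> 0.
    elim: n {Bxn} => [|n IH]; first by rewrite expr0; apply/eqP; exact: intA.1.
    by rewrite exprS => /intA.2 [/eqP|//]; rewrite (negbTE x0).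
  have [_ H] := Hb n; apply: (H [:: x ^+ n]) => [y|c]; first by rewrite inE => /eqP ->.
  rewrite big_ord1 /= => cx i; rewrite (ord1 i); apply/eqP; apply: contrapT => /negP c0.
  by apply: xn0; rewrite -(scale1r (x ^+ n)) -(mulVf c0) -scalerA cx scaler0.
have Db n r : (0 < n)%N -> (D n r <= b n)%N.
  by move=> n1; apply: dim_le (HD n r n1) (Hb n) _ => x; exact: FB.
have Dmono n r s : (0 < n)%N -> r <= s -> (D n s <= D n r)%N.
  by move=> n1 rs; apply: dim_le (HD n s n1) (HD n r n1) _ => x; exact: Fanti.
have bC' n : (b n <= C * n.+1 ^ d)%N.
  by have [[s [<- [sB fs]]] _] := Hb n; exact: bC.
pose G n t : R := (D n (n%:R * t))%:R / (b n)%:R.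
have tails : forall t e : R, 0 < e -> exists P, (0 < P)%N /\ forall p, (P <= p)%N ->
     exists n0, forall n, (n0 <= n)%N -> G p t - e <= G n (t - e).
  apply: (@dim_ratio_almost_increasing R b D d C b0 bC' Db Dmono) => t e e0.
  have [P [P0 HP]] := main t e e0; exists P; split=> // p Pp.
  have p1 : (1 <= p)%N by exact: leq_trans Pp.
  have [n0 Hn0] := HP p Pp; exists (maxn n0 1) => n; rewrite geq_max => /andP[n0n n1].
  have [k [k0 kp kB kF]] := Hn0 n n0n; exists k; split=> //.
    have [[s [<- [sB fs]]] _] := Hb p; have [s' [fs' s'B ss']] := kB s fs sB.
    by apply: (leq_trans ss'); have [_] := Hb n; apply.
  have [[s [<- [sF fs]]] _] := HD p (p%:R * t) p1; have [s' [fs' s'F ss']] := kF s fs sF.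
  by apply: (leq_trans ss'); have [_] := HD n (n%:R * (t - e)) n1; apply.
have bR n : 0 < (b n)%:R :> R by rewrite ltr0n.
have G01 n t : (0 < n)%N -> 0 <= G n t <= 1.
  by move=> n1; rewrite divr_ge0 //= ler_pdivrMr // mul1r ler_nat; exact: Db.
have Gmono n s t : (0 < n)%N -> s <= t -> G n t <= G n s.
  move=> n1 st; apply: ler_wpM2r; first by rewrite invr_ge0 ltW.
  by rewrite ler_nat; apply: Dmono => //; exact: ler_wpM2l.
have GC1 n (t : R) : (0 < n)%N -> t <= - C1 -> G n t = 1.
  move=> n1 tC; rewrite /G; have -> : D n (n%:R * t) = b n.
    apply/eqP; rewrite eqn_leq Db //=; apply: dim_le (Hb n) (HD n _ n1) _ => x Bx.
    apply: Fanti (HC1 n x n1 Bx) => //.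
    by rewrite -mulNr mulrC; apply: ler_wpM2r.
  by rewrite divff // gt_eqF.
have GC2 n (t : R) : (0 < n)%N -> C2 < t -> G n t = 0.
  move=> n1 tC; rewrite /G; suff -> : D n (n%:R * t) = 0%N by rewrite mul0r.
  have [[[|x s] [<- [sF fs]]] _] := HD n (n%:R * t) n1; first by [].
  exfalso; have x0 : x <> 0.
    move=> x0; have := fs (fun i => if i == ord0 then 1 else 0).
    rewrite big_ord_recl /= x0 scaler0 add0r big1 => [/(_ erefl ord0)|i _]; last by rewrite scale0r.
    by rewrite eqxx => /eqP; rewrite oner_eq0.
  have Fx := sF x (mem_head _ _).
  have := HC2 n _ x n1 (FB _ _ _ n1 Fx) x0 Fx.
  by rewrite mulrC ler_pM2r ?ltr0n // leNgt tC.
pose nus n : {measure set R -> \bar R} := Tscale (n%:R)^-1 (mu n).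
have TsG n t : (0 < n)%N -> nus n `[t, +oo[%classic = (G n t)%:E.
  move=> n1; rewrite /nus /Tscale /= /pushforward.
  rewrite -(muB n n1 (n%:R * t) _ _ (Hb n) (HD n _ n1)); congr (mu n _).
  apply/seteqP; split=> x /=; rewrite !in_itv /= !andbT.
    by rewrite ler_pdivlMr ?ltr0n // mulrC.
  by rewrite ler_pdivlMr ?ltr0n // mulrC.
have TsT n : nus n setT = 1%E.
  by rewrite /nus /Tscale /= /pushforward preimage_setT probability_setT.
split.
  exists (- C1), C2 => n n1 x Sx; rewrite /= in_itv /=; apply/andP; split.
    rewrite leNgt; apply/negP => xC.
    have Hpos : (0 < nus n `]-oo, (- C1)%R[%classic)%E by apply: Sx; [exact: lray_open|rewrite /= in_itv].
    move: (TsT n); rewrite -(setUv (`]-oo, (- C1)%R[%classic : set R)) setCitvl measureU //; last first.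
      by apply/seteqP; split=> // y /= []; rewrite !in_itv /= andbT ltNge => /negP.
    have Ec : nus n `[(- C1), +oo[%classic = 1%:E by rewrite TsG // GC1.
    move=> E0; have E : (nus n `]-oo, (- C1)%R[%classic + 1 = 1)%E := etrans (congr1 (adde _) (esym Ec)) E0.
    by have := @lteDr R 1%E (nus n `]-oo, (- C1)%R[%classic) erefl; rewrite E ltxx Hpos.
  rewrite leNgt; apply/negP => Cx.
  pose r := (C2 + x) / 2; have [Cr rx] : C2 < r /\ r < x by split; rewrite /r; lra.
  have Hpos : (0 < nus n `]r, +oo[%classic)%E by apply: Sx; [exact: rray_open|rewrite /= in_itv /= rx].
  have : (nus n `]r, +oo[%classic <= nus n `[r, +oo[%classic)%E.
    by apply: le_measure; rewrite ?inE // => y /=; rewrite !in_itv /= !andbT; exact: ltW.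
  by rewrite TsG // GC2 // leNgt Hpos.
have [T [Tmono Trc Ta Tb HT]] := limit_tail G01 Gmono GC1 GC2 tails.
have [nu nuT] := tail_measure Tmono Trc Ta Tb.
exists nu; apply: vague_of_tails TsT nuT _ => s t e st e0.
have [P HP] := HT s t e st e0; exists (maxn P 1) => n; rewrite geq_max => /andP[Pn n1].
by rewrite (TsG n t n1) !lee_fin; exact: HP.
Qed.
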